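(* Let $M$ be a seven-dimensional Riemannian manifold equipped with a $G_2$-structure with fundamental three-form $\varphi$ and intrinsic torsion $\xi$, written as $\xi_XY=Y\times T(X)$. Then the $G_2$-components $T_{(k)}$ of $T$, and the corresponding components $(\xi_{(k)})_XY=Y\times T_{(k)}(X)$ of $\xi$, are given in terms of $d\varphi$ and $d\star\varphi$, with respect to any local Cayley frame $\{e_0,\dots,e_6\}$, by the following formulas. (1) $T_{(1)}=\frac1{84}(d\varphi,\star\varphi)\,\mathrm{Id}_{TM}$, and $(\xi_{(1)})_XY=\frac1{84}(d\varphi,\star\varphi)\,Y\times X$. (2) $(\xi_{(2)})_XY=Y\times T_{(2)}(X)$, where $$T_{(2)}=\frac1{12}\sum_{i,j\in\mathbb Z_7,\,i\neq j}\Big(d\star\varphi+\tfrac13\,pd^\star\varphi\wedge\star\varphi\,,\ \star(e_i^*\wedge e_j^* )\Big)\,(e_i\otimes e_j^*-e_j\otimes e_i^* ).$$ (3) $(\xi_{(3)})_XY=Y\times T_{(3)}(X)$, where $$T_{(3)}=\frac16\sum_{i\in\mathbb Z_7}\Big(d\varphi\,,\ e_i^*\wedge(e_i\lrcorner\star\varphi)-\tfrac47\star\varphi\Big)\,e_i\otimes e_i^*+\frac1{12}\sum_{i,j\in\mathbb Z_7,\,i\neq j}\Big(d\varphi\,,\ e_i^*\wedge(e_j\lrcorner\star\varphi)+e_j^*\wedge(e_i\lrcorner\star\varphi)\Big)\,(e_i\otimes e_j^*+e_j\otimes e_i^* ).$$ (4) $T_{(4)}=\frac1{36}A_{(pd^\star\varphi)^\sharp}$,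 and $(\xi_{(4)})_XY=\frac1{36}\,Y\times A_{(pd^\star\varphi)^\sharp}(X)=\frac1{36}\,Y\times\big(X\times(pd^\star\varphi)^\sharp\big)$.
   Context: Indices are taken in $\mathbb Z_7$. A $G_2$-structure on a Riemannian 7-manifold $(M,\langle\cdot,\cdot\rangle)$ is a reduction of the orthonormal frame bundle to $G_2$; equivalently, a global three-form $\varphi$ such that around each point there is a local orthonormal frame $\{e_0,\dots,e_6\}$ (a Cayley frame) with dual coframe $\{e_i^*\}$ and $\varphi=\sum_{i\in\mathbb Z_7} e_i^*\wedge e_{i+1}^*\wedge e_{i+3}^*$. The volume form is $\mathrm{vol}_M=e_0^*\wedge\dots\wedge e_6^*$ and $\star$ is the corresponding Hodge star; thus $\star\varphi=-\sum_i e_{i+2}^*\wedge e_{i+4}^*\wedge e_{i+5}^*\wedge e_{i+6}^*$. The wedge product is normalized so that $(e_{i_1}^*\wedge\dots\wedge e_{i_p}^* )(e_{i_1},\dots,e_{i_p})=1$ for distinct indices; $\lrcorner$ is interior product. On $p$-forms, $(\alpha,\beta)=\frac1{p!}\sum_{i_1,\dots,i_p}\alpha(e_{i_1},\dots,e_{i_p})\beta(e_{i_1},\dots,e_{i_p})$. The vector cross product is defined by $\langle X\times Y,Z\rangle=\varphi(X,Y,Z)$. For a vector $v$, $A_v$ is the endomorphism $A_v(u)=u\times v$. The one-form $pd^\star\varphi$ is $pd^\star\varphi=\star(\star d\varphi\wedge\varphi)=-\star(\star d\star\varphi\wedge\star\varphi)$, and $\sharp$ denotes the metric dual vector. Let $\nabla$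 be the Levi-Civita connection. Write $\mathfrak{so}(TM)=\mathfrak g_2\oplus\mathfrak g_2^\perp$, where $\mathfrak g_2$ is the subalgebra of skew endomorphisms $a$ with $a(u\times v)=a(u)\times v+u\times a(v)$, and $\mathfrak g_2^\perp$ is its orthogonal complement in $\mathfrak{so}(TM)$; one has $\mathfrak g_2^\perp=\{A_v\}$. The minimal connection $\nabla^{G_2}$ is the unique connection preserving the $G_2$-structure such that $\xi_X=\nabla^{G_2}_X-\nabla_X\in\mathfrak g_2^\perp$ for all $X$; $\xi$ is the intrinsic torsion, and $T$ is the unique endomorphism field with $\xi_XY=Y\times T(X)$. Under $G_2$ the endomorphisms of $T_mM$ decompose as $\mathbb R\,\mathrm{Id}\oplus\mathfrak g_2\oplus S_0^2\oplus\mathfrak g_2^\perp$, where $S_0^2$ is the space of trace-free symmetric endomorphisms; for an endomorphism $a$, its components in $\mathbb R\,\mathrm{Id}$, $\mathfrak g_2$, $S_0^2$, $\mathfrak g_2^\perp$ are denoted $a_{(1)}$, $a_{(2)}$, $a_{(3)}$, $a_{(4)}$ respectively.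
   Formalization: In (3) the second sum is taken over unordered pairs (i<j) rather than all i≠j, since with ordered pairs, as in (2), every off-diagonal entry of T_(3) would be twice its true value. *)

(* Defs.v *)
From HB Require Import structures.
From mathcomp Require Import all_boot all_order all_algebra perm ring.
From mathcomp Require Import all_classical all_reals all_analysis.

Set Implicit Arguments.
Unset Strict Implicit.
Unset Printing Implicit Defensive.

Import Order.TTheory GRing.Theory Num.Theory.
Import numFieldNormedType.Exports.

Local Open Scope classical_set_scope.
Local Open Scope ring_scope.

(* Pointwise, [V] is a tangent space, [g] its inner product, and [e] an
   orthonormal basis indexed by ['Z_7].  A k-form is a function of a family of
   k vectors; that it is multilinear and alternating is stated separately. *)

Definition multiform (R : realType) (V : lmodType R) (k : nat) : Type :=
  ('I_k -> V) -> R.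

Section PointwiseAlgebra.
Context {R : realType} {V : lmodType R}.
Implicit Types (g : V -> V -> R) (e : 'Z_7 -> V) (k l : nat).

Definition alternating_form k (alpha : multiform V k) : Prop :=
  (forall (v : 'I_k -> V) i (a : R) x y,
     alpha [eta v with i |-> a *: x + y] =
     a * alpha [eta v with i |-> x] + alpha [eta v with i |-> y]) /\
  (forall (v : 'I_k -> V) i j, i != j -> v i = v j -> alpha v = 0).

Definition orthonormal_basis g e : Prop :=
  (forall i j, g (e i) (e j) = (i == j)%:R) /\
  (forall v, exists c : 'Z_7 -> R, v = \sum_i c i *: e i).

(* [coframe g e I] is the decomposable form
   e_(I 0)^* /\ ... /\ e_(I (k-1))^*, with the normalization
   (a_1 /\ ... /\ a_k) (v_1, ..., v_k) = det (a_i (v_j)). *)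
Definition coframe g e k (I : 'I_k -> 'Z_7) : multiform V k :=
  fun v => \det (\matrix_(a, b) g (e (I a)) (v b)).

Definition volume_form g e : multiform V 7 := coframe g e (fun i : 'I_7 => i).

Definition cayley_form g e : multiform V 3 :=
  fun v => \sum_(i : 'Z_7) coframe g e (tnth [tuple i; i + 1; i + 3]) v.

(* With this factor the wedge product of one-forms is the determinant above. *)
Definition wedge k l (alpha : multiform V k) (beta : multiform V l) :
    multiform V (k + l) :=
  fun v => (k`! * l`!)%:R^-1 *
    \sum_(s : 'S_(k + l)) (-1) ^+ s *
      alpha (fun i => v (s (lshift l i))) * beta (fun j => v (s (rshift k j))).

Definition interior_product k (x : V) (alpha : multiform V k.+1) :
    multiform V k :=
  fun v => alpha (fun i => if unlift ord0 i is Some j then v j else x).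

Definition form_inner e k (alpha beta : multiform V k) : R :=
  k`!%:R^-1 * \sum_(I : {ffun 'I_k -> 'Z_7}) alpha (e \o I) * beta (e \o I).

(* The star operator with beta /\ hodge alpha = (beta, alpha) vol.  It is
   meaningful for k <= 7: then [codom (e \o I) ++ codom v] is the list
   e_(I 0), ..., e_(I (k-1)), v 0, ..., v (6-k), of length 7. *)
Definition hodge g e k (alpha : multiform V k) : multiform V (7 - k) :=
  fun v => k`!%:R^-1 * \sum_(I : {ffun 'I_k -> 'Z_7}) alpha (e \o I) *
    volume_form g e (fun i => (codom (e \o I) ++ codom v)`_i).

Definition sharp g (alpha : multiform V 1) : V :=
  xget 0 [set w | forall z, g w z = alpha (fun=> z)].

Definition cross g (phi : multiform V 3) (u v : V) : V :=
  xget 0 [set w | forall z, g w z = phi (tnth [tuple u; v; z])].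

Definition A_ g phi (v : V) : V -> V := fun u => cross g phi u v.

(* The endomorphism x (X) y^*. *)
Definition rank_one g (x y : V) : V -> V := fun u => g y u *: x.

Definition scalar_end : set (V -> V) := [set a | exists c : R, a = c *: id].

Definition skew_end g : set (V -> V) :=
  [set a | linear a /\ forall u v, g (a u) v = - g u (a v)].

Definition g2_end g phi : set (V -> V) :=
  [set a | skew_end g a /\
     forall u v, a (cross g phi u v) =
                 cross g phi (a u) v + cross g phi u (a v)].

Definition g2_perp_end g phi : set (V -> V) :=
  [set a | skew_end g a /\
     forall b e, g2_end g phi b -> orthonormal_basis g e ->
       \sum_i g (a (e i)) (b (e i)) = 0].

Definition tracefree_sym_end g : set (V -> V) :=
  [set a | [/\ linear a, (forall u v, g (a u) v = g u (a v)) &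
     forall e, orthonormal_basis g e -> \sum_i g (a (e i)) (e i) = 0]].

Definition G2_summand g phi k : set (V -> V) :=
  match k with
  | 1 => scalar_end
  | 2 => g2_end g phi
  | 3 => tracefree_sym_end g
  | _ => g2_perp_end g phi
  end.

(* [G2_component g phi k a], for k = 1, 2, 3, 4, is the component a_(k) of the
   unique decomposition a = a_(1) + a_(2) + a_(3) + a_(4) into the summands. *)
Definition G2_component g phi k (a : V -> V) : V -> V :=
  xget (fun=> 0)
    [set b : nat -> V -> V |
       (forall l, (1 <= l <= 4)%N -> G2_summand g phi l (b l)) /\
       a = \sum_(1 <= l < 5) b l] k.

End PointwiseAlgebra.

Section SmoothFunctions.
Context {R : realType} {n : nat}.

Fixpoint iter_derive (s : seq 'rV[R]_n) (f : 'rV[R]_n -> R) : 'rV[R]_n -> R :=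
  if s is v :: s' then fun x => 'D_v (iter_derive s' f) x else f.

(* C^oo on the open set [U]. *)
Definition smooth_on (U : set 'rV[R]_n) (f : 'rV[R]_n -> R) : Prop :=
  forall s x, U x -> differentiable (iter_derive s f) x.

End SmoothFunctions.

Record chart (R : realType) (n : nat) (S : topologicalType) := Chart {
  chart_dom : set S;
  chart_map :> S -> 'rV[R]_n;
  chart_inv : 'rV[R]_n -> S;
  chart_dom_open : open chart_dom;
  chart_codom_open : open (chart_map @` chart_dom);
  chart_mapK : forall x, chart_dom x -> chart_inv (chart_map x) = x;
  chart_map_continuous : {within chart_dom, continuous chart_map};
  chart_inv_continuous :
    {within chart_map @` chart_dom, continuous chart_inv} }.

Record smooth_manifold (R : realType) (n : nat) := SmoothManifold {
  manifold_space :> topologicalType;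
  atlas : set (chart R n manifold_space);
  manifold_hausdorff : hausdorff_space manifold_space;
  manifold_second_countable : @second_countable manifold_space;
  atlas_cover : forall p, exists2 c, atlas c & chart_dom c p;
  atlas_compatible : forall c c', atlas c -> atlas c' -> forall i,
    smooth_on (c @` (chart_dom c `&` chart_dom c'))
              (fun x => c' (chart_inv c x) ord0 i) }.

Section Tangent.
Context {R : realType} {n : nat} {M : smooth_manifold R n}.
Implicit Types (p : M) (f : M -> R).

Definition smooth_fun (U : set M) f : Prop :=
  forall c, atlas c ->
    smooth_on (c @` (U `&` chart_dom c)) (f \o chart_inv c).

Definition smooth_fun_at p f : Prop :=
  exists2 U, open_nbhs p U & smooth_fun U f.

(* Derivations at [p] of germs of smooth functions, as functions of arbitrary
   [f : M -> R]; the value 0 is imposed on those [f] which are not smooth near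
   [p], so that equal derivations are equal functions. *)
Definition derivation_at p (v : (M -> R) -> R) : Prop :=
  [/\ forall f h, smooth_fun_at p f -> smooth_fun_at p h ->
        v (f \+ h) = v f + v h,
      forall (a : R) f, smooth_fun_at p f -> v (fun q => a * f q) = a * v f,
      forall f h, smooth_fun_at p f -> smooth_fun_at p h ->
        v (f \* h) = v f * h p + f p * v h,
      forall f h, (\forall q \near p, f q = h q) -> v f = v h &
      forall f, ~ smooth_fun_at p f -> v f = 0].

Definition derivation_pred p : {pred ((M -> R) -> R)} :=
  fun v => `[< derivation_at p v >].

Lemma derivation_submod_closed p : submod_closed (derivation_pred p).
Proof.
have avwE (a : R) (v w : (M -> R) -> R) f : (a *: v + w) f = a * v f + w f.
  by [].
split=> [|a v w /asboolP[vD vZ vM vl v0] /asboolP[wD wZ wM wl w0]];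
  apply/asboolP; split=> //=.
- by move=> f h _ _; rewrite addr0.
- by move=> b f _; rewrite mulr0.
- by move=> f h _ _; rewrite mul0r mulr0 addr0.
- by move=> f h sf sh; rewrite !avwE vD// wD//; ring.
- by move=> b f sf; rewrite !avwE vZ// wZ//; ring.
- by move=> f h sf sh; rewrite !avwE vM// wM//; ring.
- by move=> f h fh; rewrite !avwE (vl f h)// (wl f h).
- by move=> f sf; rewrite avwE v0// w0// mulr0 addr0.
Qed.

HB.instance Definition _ p :=
  GRing.isSubmodClosed.Build R ((M -> R) -> R) (derivation_pred p)
    (derivation_submod_closed p).

Record tangent p := Tangent {
  tangent_val :> (M -> R) -> R;
  tangentP : tangent_val \in derivation_pred p }.

HB.instance Definition _ p := [isSub for @tangent_val p].
HB.instance Definition _ p := [Choice of tangent p by <:].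
HB.instance Definition _ p := [SubChoice_isSubLmodule of tangent p by <:].

End Tangent.

Arguments smooth_fun {R n} M U f.

(* Vector fields and fields of forms need not be smooth. *)
Definition vector_field (R : realType) (n : nat) (M : smooth_manifold R n) :=
  forall p : M, tangent p.
Definition form_field (R : realType) (n : nat) (M : smooth_manifold R n)
  (k : nat) := forall p : M, multiform (tangent p) k.

Section Fields.
Context {R : realType} {n : nat} {M : smooth_manifold R n}.
Implicit Types (p : M) (X Y Z : vector_field M).

Definition smooth_vector_field (U : set M) X : Prop :=
  forall V f, open V -> V `<=` U -> smooth_fun M V f ->
    smooth_fun M V (fun q => X q f).

Definition smooth_vector_field_at p X : Prop :=
  exists2 U, open_nbhs p U & smooth_vector_field U X.

(* [insubd] forms the tangent vector with the given value on functions; that it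
   is a derivation holds whenever X and Y are smooth near [p]. *)
Definition lie_bracket X Y : vector_field M := fun p =>
  insubd (0 : tangent p) (fun f =>
    if `[< smooth_fun_at p f >]
    then X p (fun q => Y q f) - Y p (fun q => X q f) else 0).

Definition smooth_form k (alpha : form_field M k) : Prop :=
  (forall p, alternating_form (alpha p)) /\
  (forall U (X : 'I_k -> vector_field M), open U ->
     (forall i, smooth_vector_field U (X i)) ->
     smooth_fun M U (fun q => alpha q (fun i => X i q))).

(* The invariant formula for d alpha (X_0, ..., X_k) at [p]. *)
Definition invariant_d k (alpha : form_field M k)
    (X : 'I_k.+1 -> vector_field M) p : R :=
  \sum_(i < k.+1)
     (-1) ^+ i * X i p (fun q => alpha q (fun a => X (lift i a) q)) +
  \sum_(i < k.+1) \sum_(j < k.+1 | (i < j)%N)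
     (-1) ^+ (i + j) * alpha p (fun a =>
       (lie_bracket (X i) (X j) p ::
          [seq X l p | l <- enum 'I_k.+1 & (l != i) && (l != j)])`_a).

(* The value of d alpha on tangent vectors is that of the invariant formula on
   any smooth local extensions of these vectors. *)
Definition extd k (alpha : form_field M k) : form_field M k.+1 := fun p v =>
  xget 0 [set r : R | forall X : 'I_k.+1 -> vector_field M,
    (forall i, smooth_vector_field_at p (X i)) -> (forall i, X i p = v i) ->
    r = invariant_d alpha X p].

End Fields.

Arguments lie_bracket {R n M} X Y p.
Arguments extd {R n M k} alpha p v.

Record riemannian_metric (R : realType) (n : nat) (M : smooth_manifold R n) :=
  RiemannianMetric {
  metric :> forall p : M, tangent p -> tangent p -> R;
  riemannian_sym : forall p (x y : tangent p), metric x y = metric y x;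
  riemannian_linear : forall p (a : R) (x y z : tangent p),
    metric (a *: x + y) z = a * metric x z + metric y z;
  riemannian_pos : forall p (x : tangent p), x != 0 -> 0 < metric x x;
  riemannian_smooth : forall U (X Y : vector_field M), open U ->
    smooth_vector_field U X -> smooth_vector_field U Y ->
    smooth_fun M U (fun q => metric (X q) (Y q)) }.

Arguments metric {R n M} r p x y : rename.

(* A connection on TM, acting on locally defined vector fields: [cov p x Y] is
   the derivative of [Y] in the direction [x], meaningful when [Y] is smooth
   near [p]. *)
Record connection (R : realType) (n : nat) (M : smooth_manifold R n) :=
  Connection {
  cov :> forall p : M, tangent p -> vector_field M -> tangent p;
  cov_linear : forall p (Y : vector_field M), smooth_vector_field_at p Y ->
    linear (fun x : tangent p => cov x Y);
  cov_add : forall p (x : tangent p) (Y Z : vector_field M),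
    smooth_vector_field_at p Y -> smooth_vector_field_at p Z ->
    cov x (fun q => Y q + Z q) = cov x Y + cov x Z;
  cov_leibniz : forall p (x : tangent p) f (Y : vector_field M),
    smooth_fun_at p f -> smooth_vector_field_at p Y ->
    cov x (fun q => f q *: Y q) = x f *: Y p + f p *: cov x Y;
  cov_local : forall p (x : tangent p) (Y Z : vector_field M),
    (\forall q \near p, Y q = Z q) -> cov x Y = cov x Z;
  cov_smooth : forall U (X Y : vector_field M), open U ->
    smooth_vector_field U X -> smooth_vector_field U Y ->
    smooth_vector_field U (fun q => cov (X q) Y) }.

Arguments cov {R n M} c p x Y : rename.

Section Connections.
Context {R : realType} {n : nat} {M : smooth_manifold R n}.
Implicit Types (p : M) (nabla : connection M).

Definition metric_connection (g : riemannian_metric M) nabla : Prop :=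
  forall p (x : tangent p) (Y Z : vector_field M),
    smooth_vector_field_at p Y -> smooth_vector_field_at p Z ->
    x (fun q => g q (Y q) (Z q)) =
    g p (nabla p x Y) (Z p) + g p (Y p) (nabla p x Z).

Definition torsion_free nabla : Prop :=
  forall p (X Y : vector_field M),
    smooth_vector_field_at p X -> smooth_vector_field_at p Y ->
    nabla p (X p) Y - nabla p (Y p) X = lie_bracket X Y p.

Definition levi_civita (g : riemannian_metric M) nabla : Prop :=
  metric_connection g nabla /\ torsion_free nabla.

Definition parallel_form nabla k (alpha : form_field M k) : Prop :=
  forall p (x : tangent p) (Y : 'I_k -> vector_field M),
    (forall i, smooth_vector_field_at p (Y i)) ->
    x (fun q => alpha q (fun i => Y i q)) =
    \sum_(i < k) alpha p [eta (fun j => Y j p) with i |-> nabla p x (Y i)].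

(* The tensor D_x y - nabla_x y, computed on any smooth local extension of y. *)
Definition connection_difference (D nabla : connection M) p
    (x y : tangent p) : tangent p :=
  xget 0 [set z | forall Y : vector_field M,
    smooth_vector_field_at p Y -> Y p = y -> z = D p x Y - nabla p x Y].

End Connections.

Section CayleyFrames.
Context {R : realType} {M : smooth_manifold R 7}.

Definition cayley_frame (g : riemannian_metric M) (phi : form_field M 3)
    (U : set M) (e : 'Z_7 -> vector_field M) : Prop :=
  (forall i, smooth_vector_field U (e i)) /\
  (forall q, U q -> orthonormal_basis (g q) (fun i => e i q) /\
     forall v, phi q v = cayley_form (g q) (fun i => e i q) v).

End CayleyFrames.

Record G2_structure (R : realType) (M : smooth_manifold R 7)
    (g : riemannian_metric M) := G2Structure {
  fundamental_form :> forall p : M, multiform (tangent p) 3;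
  fundamental_form_smooth : smooth_form fundamental_form;
  fundamental_form_cayley : forall p, exists U e,
    open_nbhs p U /\ cayley_frame g fundamental_form U e }.

Section G2Structures.
Context {R : realType} {M : smooth_manifold R 7} {g : riemannian_metric M}.
Implicit Types (phi : G2_structure g) (nabla D : connection M).

Definition preserves_G2_structure phi D : Prop :=
  metric_connection g D /\ parallel_form D phi.

Definition minimal_connection phi nabla D : Prop :=
  preserves_G2_structure phi D /\
  forall p (x : tangent p),
    g2_perp_end (g p) (phi p) (connection_difference D nabla x).

(* The star operator is that of the orientation of [e]; both forms are used on
   the domain of a Cayley frame [e]. *)
Definition star_phi phi (e : 'Z_7 -> vector_field M) : form_field M 4 :=
  fun q => hodge (g q) (fun i => e i q) (phi q).

Definition pdstar_phi phi (e : 'Z_7 -> vector_field M) : form_field M 1 :=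
  fun q => hodge (g q) (fun i => e i q)
    (wedge (hodge (g q) (fun i => e i q) (extd phi q)) (phi q)).

End G2Structures.

Arguments star_phi {R M g} phi e p v.
Arguments pdstar_phi {R M g} phi e p v.

(* Main.v *)
Require Import Defs.
From mathcomp Require Import all_boot all_order all_algebra perm ring lra zify.
From mathcomp Require Import all_classical all_reals all_analysis.

Set Implicit Arguments.
Unset Strict Implicit.
Unset Printing Implicit Defensive.

Import Order.TTheory GRing.Theory Num.Theory.
Import numFieldNormedType.Exports.

Local Open Scope classical_set_scope.
Local Open Scope ring_scope.

(** Let [D] be the minimal connection and psi the dual four-form, so that
[D_X Y = nabla_X Y + Y x T(X)]. The connection [D] preserves the metric and phi,
hence also psi, which is built from both ([hodge_cayley], [star_phi_parallel]).
Since nabla has no torsion, the invariant formula for an exterior derivative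
reduces to an alternation of the derivative by nabla ([extd_torsion]); for the
parallel forms phi and psi it reads, at a point,

  d phi (v_0, ..., v_3) = sum_i (-1)^i sum_(j <> i) phi (..., v_j x T(v_i), ...),

and similarly for psi. Such a value involves only the restriction of [T] to the
point, and in a Cayley frame it is a combination of the entries [t m a] of the
matrix of [T] whose coefficients are integers made of the structure constants of
the cross product ([d_components]).

The forms in the theorem are evaluated through one observation: a wedge product
and a decomposable form are antisymmetrizations, and pairing an antisymmetric
function with an antisymmetrization is pairing it with the function that was
antisymmetrized ([sum_antisymmetrize]). Therefore pairing with a decomposable
form is evaluation, and the star of a form on basis vectors is, up to sign, the
form on the complementary basis vectors ([pair_volume], [hodge_basis]). Every
quantity of the theorem becomes a combination of the [t m a] with integer
coefficients, and finitely many integer identities give, with [P i j] the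
contraction of psi with [T] and [tr] the trace of [T],

  (d phi, psi) = 12 tr,
  (d phi, e_i /\ (e_j _| psi) + e_j /\ (e_i _| psi)) =
    6 (t i j + t j i) + 12 delta_ij tr,
  pd (e_j) = 6 sum_(m, a) t m a phi (e_j, e_m, e_a),
  (d psi + pd /\ psi / 3, star (e_i /\ e_j)) = 2 (t i j - t j i) + P i j.

So the four claimed endomorphisms have the entries [delta_ij tr / 7],
[(2 (t i j - t j i) + P i j) / 6], [(t i j + t j i) / 2 - delta_ij tr / 7] and
[(t i j - t j i - P i j) / 6], whose sum is [t i j] ([torsion_sum]). They lie in the
four summands: the second is a derivation of the cross product by a further
integer identity ([g2_part_coef_g2]), and the operators [A_v] are orthogonal to
all derivations ([A_g2_perp]). As the summands are independent
([G2_componentE]), these are the components of [T]. *)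

(** * Alternating forms *)

Section Antisymmetry.
Context {R : realType} {V : lmodType R}.

(** Also used for functions of a family of indices, where multilinearity makes no
sense. *)
Definition antisymmetric_fun (X : Type) k (a : ('I_k -> X) -> R) : Prop :=
  forall (v : 'I_k -> X) (s : 'S_k), a (v \o s) = (-1) ^+ s * a v.

Lemma alternating_add k (al : multiform V k) : alternating_form al ->
  forall (v : 'I_k -> V) i x y,
  al [eta v with i |-> x + y] = al [eta v with i |-> x] + al [eta v with i |-> y].
Proof. by move=> [L _] v i x y; have := L v i 1 x y; rewrite scale1r mul1r. Qed.

(** The form vanishes when both places hold [v i + v j]; expanding leaves the two
mixed terms. *)
Lemma alternating_swap k (al : multiform V k) : alternating_form al ->
  forall (v : 'I_k -> V) i j, i != j -> al (v \o tperm i j) = - al v.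
Proof.
move=> alal v i j nij.
pose w x y : 'I_k -> V := fun l => if l == i then x else if l == j then y else v l.
have w1 x y : w x y = [eta w 0 y with i |-> x].
  by apply/funext => l /=; rewrite /w; case: eqP.
have w2 x y : w x y = [eta w x 0 with j |-> y].
  apply/funext => l /=; rewrite /w; case: (eqVneq l j) => // ->.
  by rewrite eq_sym (negbTE nij).
have wD1 x x' y : al (w (x + x') y) = al (w x y) + al (w x' y).
  by rewrite w1 (alternating_add alal) -!w1.
have wD2 x y y' : al (w x (y + y')) = al (w x y) + al (w x y').
  by rewrite w2 (alternating_add alal) -!w2.
have w0 x : al (w x x) = 0.
  apply: (alal.2 _ i j nij).
  by rewrite /w eqxx; case: ifP => //; rewrite eqxx.
have := w0 (v i + v j); rewrite wD1 !wD2 !w0 add0r addr0 => /eqP.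
rewrite addr_eq0 => /eqP h.
have -> : v \o tperm i j = w (v j) (v i).
  apply/funext => l /=; rewrite /w; case: tpermP => [->|->|/eqP li /eqP lj].
  - by rewrite eqxx.
  - by rewrite eqxx eq_sym (negbTE nij).
  - by rewrite (negbTE li) (negbTE lj).
have -> : al v = al (w (v i) (v j)).
  congr al; apply/funext => l; rewrite /w.
  by case: eqP => [->//|_]; case: eqP => [->|].
by rewrite h opprK.
Qed.

(** A permutation is a product of transpositions. *)
Lemma alternating_antisymmetric k (al : multiform V k) :
  alternating_form al -> antisymmetric_fun al.
Proof.
move=> alal v s; have [ts -> /allP dts] := prod_tpermP s.
elim: ts dts => [_|t ts IH dts].
  rewrite big_nil odd_perm1 mul1r; congr al; apply/funext => l /=.
  by rewrite perm1.
have nt : t.1 != t.2 by exact: dts (mem_head _ _).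
rewrite big_cons odd_mul_tperm nt signr_addb expr1 mulN1r mulNr.
rewrite -IH => [|u uts]; last by apply: dts; rewrite inE uts orbT.
rewrite -(alternating_swap alal (v \o _) nt).
by congr al; apply/funext => l /=; rewrite permM.
Qed.

Lemma det_alternating (n : nat) (h : 'I_n -> V -> R) :
  (forall i a x y, h i (a *: x + y) = a * h i x + h i y) ->
  alternating_form (fun v : 'I_n -> V => \det (\matrix_(a, b) h a (v b))).
Proof.
move=> hL; split=> [v i c x y|v i j nij vij].
- pose A z := (\matrix_(a, b) h a ([eta v with i |-> z] b))^T.
  have : \det (A (c *: x + y)) = c * \det (A x) + 1 * \det (A y).
    apply: (@determinant_multilinear _ _ _ _ _ i).
    + by apply/rowP => l; rewrite !mxE /= eqxx hL mul1r.
    + apply/matrixP => r s; rewrite !mxE /= [lift _ _ == _]eq_sym.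
      by rewrite (negbTE (neq_lift i r)).
    + apply/matrixP => r s; rewrite !mxE /= [lift _ _ == _]eq_sym.
      by rewrite (negbTE (neq_lift i r)).
  by rewrite !det_tr mul1r.
- rewrite -det_tr; apply: (@determinant_alternate _ _ _ i j nij) => l.
  by rewrite !mxE vij.
Qed.

(** The arguments are expanded in the spanning family one after the other: at
stage [m] the arguments from the [m]-th on already belong to it. *)
Lemma multilinear_ext (I : finType) (e : I -> V) k (al : multiform V k) :
  (forall v, exists c : I -> R, v = \sum_i c i *: e i) ->
  (forall (v : 'I_k -> V) i (a : R) x y,
     al [eta v with i |-> a *: x + y] =
     a * al [eta v with i |-> x] + al [eta v with i |-> y]) ->
  (forall J : 'I_k -> I, al (e \o J) = 0) -> forall v, al v = 0.
Proof.
move=> span L al0.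
suff H m : forall v, (forall i : 'I_k, (m <= i)%N -> exists j, v i = e j) -> al v = 0.
  move=> v; apply: (H k) => i; by rewrite leqNgt ltn_ord.
elim: m => [v hv|m IH v hv].
  have [J hJ] := choice (fun i => hv i (leq0n i)).
  by rewrite (_ : v = e \o J) //; apply/funext => i; rewrite hJ.
have [mk|km] := ltnP m k; last first.
  apply: IH => i mi; have := ltn_ord i; lia.
pose i := Ordinal mk; have [c vc] := span (v i).
have -> : v = [eta v with i |-> v i].
  by apply/funext => l /=; case: eqP => [->|].
(* The empty sum is handled as [-1 *: 0 + 0]. *)
rewrite vc; elim/big_rec: _ => [|j y _ hy].
  have := L v i (-1) 0 0; rewrite scaler0 addr0 => ->; lra.
rewrite L hy addr0 IH ?mulr0 // => l ml /=.
case: eqP => [_|li]; first by exists j.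
apply: hv; rewrite ltn_neqAle ml andbT; apply/eqP => ml'.
by apply: li; apply/val_inj.
Qed.

End Antisymmetry.

(** * Antisymmetric functions and their pairings *)

Section Fronts.
Context {R : realType} {X : Type}.

Definition vcons k (x : X) (v : 'I_k -> X) : 'I_k.+1 -> X :=
  fun i => if unlift ord0 i is Some j then v j else x.

Lemma vcons0 k (x : X) (v : 'I_k -> X) : vcons x v ord0 = x.
Proof. by rewrite /vcons unlift_none. Qed.

Lemma vconsS k (x : X) (v : 'I_k -> X) j : vcons x v (lift ord0 j) = v j.
Proof. by rewrite /vcons liftK. Qed.

(** The permutation that brings the [i]-th place to the front and keeps the order
of the others has sign [(-1) ^ i]. *)
Lemma pull_front k (a : ('I_k.+1 -> X) -> R) : antisymmetric_fun a ->
  forall v (i : 'I_k.+1), a v = (-1) ^+ i * a (vcons (v i) (v \o lift i)).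
Proof.
move=> aa v i; have := aa v (lift_perm ord0 i 1%g).
rewrite odd_lift_perm /= odd_perm1 addbF signr_odd => h.
have -> : vcons (v i) (v \o lift i) = v \o lift_perm ord0 i 1%g.
  apply/funext => l /=; rewrite /vcons; case: unliftP => [j ->|->] /=.
    by rewrite lift_perm_lift perm1.
  by rewrite lift_perm_id.
by rewrite h mulrA -expr2 sqrr_sign mul1r.
Qed.

Lemma perm_lift k (s : 'S_k.+1) (i : 'I_k.+1) :
  exists s' : 'S_k, s = lift_perm i (s i) s'.
Proof.
have h j : s i != s (lift i j) by rewrite (inj_eq perm_inj) neq_lift.
pose f j := odflt j (unlift (s i) (s (lift i j))).
have fE j : lift (s i) (f j) = s (lift i j).
  by rewrite /f; have /unlift_some[l -> ->] := h j.
have finj : injective f.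
  move=> j1 j2 ff; apply: (@lift_inj _ i); apply: (@perm_inj _ s).
  by rewrite -!fE ff.
exists (perm finj); apply/permP => l.
case: (unliftP i l) => [j ->|->]; last by rewrite lift_perm_id.
by rewrite lift_perm_lift permE fE.
Qed.

(** A permutation moving [i] to [j] restricts, off these indices, to a permutation
whose sign differs from its own by [(-1) ^ (i + j)]. *)
Lemma alternation_antisymmetric k (ga : X -> ('I_k -> X) -> R) :
  (forall x, antisymmetric_fun (ga x)) ->
  antisymmetric_fun (fun v : 'I_k.+1 -> X =>
    \sum_(i < k.+1) (-1) ^+ i * ga (v i) (v \o lift i)).
Proof.
move=> ha v s /=; rewrite mulr_sumr [RHS](reindex_inj (@perm_inj _ s)).
apply: eq_bigr => i _; have [s' sE] := perm_lift s i.
have -> : (v \o s) \o lift i = (v \o lift (s i)) \o s'.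
  by apply/funext => j /=; rewrite [in LHS]sE lift_perm_lift.
rewrite ha !mulrA; congr (_ * _).
have so : odd_perm s = odd i (+) odd (s i) (+) odd_perm s'.
  by rewrite [in LHS]sE odd_lift_perm.
rewrite -[(-1) ^+ i]signr_odd -[(-1) ^+ nat_of_ord (s i)]signr_odd -!signr_addb so.
by case: (odd i) (odd (s i)) (odd_perm s') => [] [] [].
Qed.

End Fronts.

Section Concatenation.
Context {A : Type}.
Definition fcat m n (I : 'I_m -> A) (K : 'I_n -> A) : 'I_(m + n) -> A :=
  fun i => match fintype.split i with inl a => I a | inr b => K b end.

Lemma fcat_l m n (I : 'I_m -> A) (K : 'I_n -> A) i : fcat I K (lshift n i) = I i.
Proof. by rewrite /fcat -[lshift n i]/(unsplit (inl i)) unsplitK. Qed.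

Lemma fcat_r m n (I : 'I_m -> A) (K : 'I_n -> A) i : fcat I K (rshift m i) = K i.
Proof. by rewrite /fcat -[rshift m i]/(unsplit (inr i)) unsplitK. Qed.

Lemma fcat_eta m n (J : 'I_(m + n) -> A) :
  fcat (J \o lshift n) (J \o @rshift m n) = J.
Proof.
apply/funext => i; rewrite -(splitK i); case: (fintype.split i) => j /=.
  by rewrite fcat_l.
by rewrite fcat_r.
Qed.

End Concatenation.

Section Pairing.
Context {R : realType} {A : finType}.

(** After reindexing by the permutation [s], the term of [s] no longer depends on
it, because the two signs cancel. *)
Lemma sum_antisymmetrize k (a G : ('I_k -> A) -> R) : antisymmetric_fun a ->
  \sum_(I : {ffun 'I_k -> A}) a I * (\sum_(s : 'S_k) (-1) ^+ s * G (I \o s)) =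
  k`!%:R * \sum_(I : {ffun 'I_k -> A}) a I * G I.
Proof.
move=> aa; under eq_bigr do rewrite mulr_sumr.
rewrite exchange_big /=.
rewrite (eq_bigr (fun _ => \sum_(I : {ffun 'I_k -> A}) a I * G I)).
  by rewrite sumr_const card_Sn mulr_natl.
move=> s _.
pose f (I : {ffun 'I_k -> A}) := [ffun i => I (s i)].
have fE I : f I = I \o s :> ('I_k -> A) by apply/funext => i; rewrite ffunE.
have finj : injective f.
  move=> I I' /ffunP h; apply/ffunP => i.
  by have := h (s^-1%g i); rewrite !ffunE permKV.
rewrite [RHS](reindex_inj finj); apply: eq_bigr => I _.
by rewrite fE aa mulrCA mulrA.
Qed.

Lemma sum_fcat m n (F : ('I_(m + n) -> A) -> R) :
  \sum_(J : {ffun 'I_(m + n) -> A}) F J =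
  \sum_(I : {ffun 'I_m -> A}) \sum_(K : {ffun 'I_n -> A}) F (fcat I K).
Proof.
rewrite pair_big /=.
pose h (p : {ffun 'I_m -> A} * {ffun 'I_n -> A}) : {ffun 'I_(m + n) -> A} :=
  [ffun i => fcat p.1 p.2 i].
pose h' (J : {ffun 'I_(m + n) -> A}) :=
  ([ffun i => J (lshift n i)], [ffun i => J (@rshift m n i)]).
rewrite (reindex h); last first.
  exists h' => [[I K] _|J _].
    by congr (_, _); apply/ffunP => i; rewrite !ffunE ?fcat_l ?fcat_r.
  apply/ffunP => i; rewrite ffunE -[RHS](congr1 (fun f => f i) (fcat_eta J)).
  by congr fcat; apply/funext => j /=; rewrite ffunE.
apply: eq_bigr => p _; congr F; apply/funext => i.
by rewrite ffunE.
Qed.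

Lemma sum_ffun1 (F : ('I_1 -> A) -> R) :
  \sum_(I : {ffun 'I_1 -> A}) F I = \sum_(a : A) F (fun=> a).
Proof.
rewrite (reindex (fun a : A => [ffun _ : 'I_1 => a])); last first.
  exists (fun I : {ffun 'I_1 -> A} => I ord0) => [a _|I _]; first by rewrite ffunE.
  by apply/ffunP => i; rewrite ffunE (ord1 i).
by apply: eq_bigr => a _; congr F; apply/funext => i; rewrite ffunE.
Qed.

End Pairing.

(** * Signs of index lists *)

Definition omit_nth (i : nat) (s : seq nat) : seq nat := take i s ++ drop i.+1 s.

(** For [I] without repetition, the determinant of the Kronecker symbols of [I] and
[J]: [None] stands for 0 and [Some b] for [(-1) ^ b]. The recursion is the
expansion along the first column, which has at most one nonzero entry. *)
Fixpoint delta_sign (I J : seq nat) : option bool :=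
  if J is j :: J' then
    if j \in I then omap (addb (odd (index j I))) (delta_sign (rem j I) J') else None
  else Some false.

Definition int_of_sign (o : option bool) : int :=
  if o is Some b then if b then Negz 0 else Posz 1 else Posz 0.

(** Families of indices are turned into lists of numbers, on which signs and
coefficients are computed. *)
Definition vals (k n : nat) (K : 'I_k -> 'I_n) : seq nat :=
  [seq val (K i) | i <- enum 'I_k].

Lemma nth_omit_nth i s l : (i < size s)%N -> nth 0%N (omit_nth i s) l =
  nth 0%N s (bump i l).
Proof.
move=> si; rewrite /omit_nth nth_cat size_takel ?(ltnW si) // /bump.
by case: ltnP => li; rewrite ?nth_take // nth_drop; congr nth; lia.
Qed.

Lemma size_omit_nth i s : (i < size s)%N -> size (omit_nth i s) = (size s).-1.
Proof. by move=> si; rewrite /omit_nth size_cat size_drop size_takel ?(ltnW si) //;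
  lia. Qed.

Section Natl.
Variables (n : nat).

Lemma size_vals k (K : 'I_k -> 'I_n) : size (vals K) = k.
Proof. by rewrite size_map size_enum_ord. Qed.

Lemma nth_vals k (K : 'I_k -> 'I_n) (i : 'I_k) : nth 0%N (vals K) i = K i.
Proof. by rewrite (nth_map i) ?size_enum_ord // nth_ord_enum. Qed.

Lemma vals_eq k (K : 'I_k -> 'I_n) s : size s = k ->
  (forall i : 'I_k, nth 0%N s i = K i) -> vals K = s.
Proof.
move=> sk h; apply: (@eq_from_nth _ 0%N); rewrite size_vals ?sk // => i ik.
by rewrite (nth_vals K (Ordinal ik)) -h.
Qed.

Lemma vals_lift k (K : 'I_k.+1 -> 'I_n) i : vals (K \o lift i) = omit_nth i (vals K).
Proof.
apply: vals_eq; first by rewrite size_omit_nth size_vals.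
by move=> j; rewrite nth_omit_nth ?size_vals // (nth_vals K (lift i j)).
Qed.

Lemma vals_fcat k l (I : 'I_k -> 'I_n) (K : 'I_l -> 'I_n) :
  vals (fcat I K) = vals I ++ vals K.
Proof.
apply: vals_eq; first by rewrite size_cat !size_vals.
move=> i; rewrite nth_cat size_vals -(splitK i).
case: (fintype.split i) => j /=; first by rewrite ltn_ord nth_vals fcat_l.
by rewrite ltnNge leq_addr /= addKn nth_vals fcat_r.
Qed.

Lemma vals_vcons k a (K : 'I_k -> 'I_n) : vals (vcons a K) = val a :: vals K.
Proof.
apply: vals_eq; first by rewrite /= size_vals.
by move=> i; case: (unliftP ord0 i) => [j ->|->]; rewrite ?vconsS ?vcons0 //= nth_vals.
Qed.

Lemma vals_lt k (K : 'I_k -> 'I_n) : all (fun i => i < n)%N (vals K).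
Proof. by apply/allP => i /mapP[j _ ->]; exact: ltn_ord. Qed.

Lemma vals_surj k s : size s = k -> all (fun i => i < n)%N s ->
  exists K : 'I_k -> 'I_n, vals K = s.
Proof.
move=> sk /allP sn.
have h (i : 'I_k) : (nth 0%N s i < n)%N by apply/sn/mem_nth; rewrite sk.
by exists (fun i => Ordinal (h i)); apply: vals_eq.
Qed.

End Natl.

Section DetSign.
Context {R : realType}.

Lemma det_delta_sign k (I J : seq nat) : size I = k -> size J = k -> uniq I ->
  \det (\matrix_(a < k, b < k) (nth 0%N I a == nth 0%N J b)%:R) =
  (int_of_sign (delta_sign I J))%:~R :> R.
Proof.
elim: k I J => [|k IH] I J sI sJ uI.
  by rewrite (size0nil sJ) det_mx00.
case: J sJ => [|j J] //= [sJ].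
rewrite (expand_det_col _ ord0).
have [jI|jI] := boolP (j \in I); last first.
  rewrite big1 // => a _; rewrite mxE /=; case: eqP => [h|]; last by rewrite mul0r.
  by rewrite -h mem_nth ?sI // in jI.
have ij : (index j I < k.+1)%N by rewrite -sI index_mem.
rewrite (bigD1 (Ordinal ij)) //= big1 ?addr0 => [|a ai]; last first.
  rewrite mxE /=; case: eqP => [h|]; last by rewrite mul0r.
  case/eqP: ai; apply/val_inj => /=.
  by rewrite -h index_uniq ?sI.
rewrite mxE /= nth_index // eqxx mul1r /cofactor addn0.
have -> : row' (Ordinal ij) (col' ord0 (\matrix_(a, b) (nth 0%N I a == nth 0%N (j ::
  J) b)%:R))
   = \matrix_(a < k, b < k) (nth 0%N (rem j I) a == nth 0%N J b)%:R :> 'M[R]_k.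
  apply/matrixP => a b; rewrite !mxE remE -/(omit_nth _ _) nth_omit_nth ?sI //.
rewrite IH ?size_rem ?sI ?rem_uniq //.
case: delta_sign => [b|] /=; last by rewrite mulr0.
by rewrite -signr_odd /=;
  case: (odd _) b => [] []; rewrite /= ?expr0 ?expr1 ?mulNr ?mul1r ?mulrNz ?opprK.
Qed.

(** The indices matched by the first columns are removed from the rows, so that a
sign of a concatenation splits into two signs. *)
Lemma delta_sign_cat I J K : uniq I -> delta_sign I (J ++ K) =
  if delta_sign I J is Some b then omap (addb b)
    (delta_sign [seq i <- I | i \notin J] K) else None.
Proof.
elim: J I => [|j J IH] I uI /=.
  by rewrite (eq_filter (a2 := predT)) ?filter_predT //; case: delta_sign.
case: ifP => // jI; rewrite IH ?rem_uniq //; case: delta_sign => //= b.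
rewrite rem_filter // -filter_predI (eq_filter (a2 := [pred i | i \notin j :: J])).
  by case: delta_sign => //= c; rewrite addbA.
by move=> i /=; rewrite inE negb_or andbC.
Qed.

Lemma delta_sign_uniq I J b : uniq I -> delta_sign I J = Some b ->
  uniq J /\ {subset J <= I}.
Proof.
elim: J I b => [|j J IH] I b uI //=; case: ifP => // jI.
case E: delta_sign => [c|] //= _; have [uJ JI] := IH _ _ (rem_uniq j uI) E.
split; last first.
  by move=> i; rewrite inE => /orP[/eqP->//|/JI /mem_rem].
rewrite uJ andbT; apply/negP => /JI; rewrite mem_rem_uniq // inE eqxx //.
Qed.

(** The coefficients of a decomposable form are determinants of Kronecker symbols,
which antisymmetrize the indicator of [C]: pairing with it is evaluation. *)
Lemma pair_coframe n k (b : seq nat -> R) (C : seq nat) :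
  antisymmetric_fun (fun K : 'I_k -> 'I_n => b (vals K)) ->
  size C = k -> uniq C -> all (fun i => i < n)%N C ->
  k`!%:R^-1 * \sum_(K : {ffun 'I_k ->
    'I_n}) b (vals K) * (int_of_sign (delta_sign C (vals K)))%:~R = b C.
Proof.
move=> ab sC uC Cn; have [L LC] := vals_surj sC Cn.
have E (K : 'I_k -> 'I_n) : (int_of_sign (delta_sign C (vals K)))%:~R =
    \sum_(s : 'S_k) (-1) ^+ s * \prod_(i < k) (L i == (K \o s) i)%:R :> R.
  rewrite -(@det_delta_sign k) ?size_vals //; apply: eq_bigr => s _; congr (_ * _).
  by apply: eq_bigr => i _; rewrite mxE -LC !nth_vals.
under eq_bigr do rewrite E.
rewrite (sum_antisymmetrize (fun J : 'I_k -> 'I_n => \prod_(i < k) (L i == J i)%:R) ab).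
rewrite mulrA mulVf ?mul1r ?pnatr_eq0 -?lt0n ?fact_gt0 //.
rewrite (bigD1 [ffun i => L i]) //= [X in _ + X]big1 ?addr0 => [|K KL].
  rewrite big1 ?mulr1 => [|i _]; last by rewrite ffunE eqxx.
  by rewrite -LC; congr b; congr vals; apply/funext => i; rewrite ffunE.
have [i Li] : exists i, L i != K i.
  apply/existsP; rewrite -[X in is_true X]negbK negb_exists; apply/negP => /forallP h.
  case/eqP: KL; apply/ffunP => i; rewrite ffunE; apply/eqP.
  by have := h i; rewrite negbK eq_sym.
by rewrite (bigD1 i) //= (negbTE Li) mul0r mulr0.
Qed.

End DetSign.

(** * The volume form and the star operator on a frame *)

Section SignVolume.
Context {R : realType}.

Lemma delta_sign_antisymmetric n k (C : seq nat) : size C = k -> uniq C ->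
  antisymmetric_fun (fun K : 'I_k -> 'I_n => (int_of_sign (delta_sign C (vals K)))%:~R : R).
Proof.
move=> sC uC v s; rewrite -!(@det_delta_sign _ k) ?size_vals //.
have -> : \matrix_(a < k, b < k) (nth 0%N C a == nth 0%N (vals (v \o s)) b)%:R =
  col_perm s (\matrix_(a < k, b < k) (nth 0%N C a == nth 0%N (vals v) b)%:R) :> 'M[R]_k.
  by apply/matrixP => a b; rewrite !mxE !nth_vals.
by rewrite col_permE det_mulmx det_perm odd_permV mulrC.
Qed.

Definition vol_sign (s : seq nat) : int := int_of_sign (delta_sign (iota 0 7) s).
Definition co_indices (s : seq nat) : seq nat := [seq i <- iota 0 7 | i \notin s].

Lemma size_co_indices s : uniq s -> {subset s <= iota 0 7} -> size (co_indices s) =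
  (7 - size s)%N.
Proof.
move=> us sn; rewrite /co_indices size_filter.
have <- : count (mem s) (iota 0 7) = size s.
  rewrite -size_filter; apply/perm_size/uniq_perm; rewrite ?filter_uniq ?iota_uniq // => i.
  by rewrite mem_filter /=; case: (boolP (i \in s)) => // /sn ->.
have := count_predC (mem s) (iota 0 7); rewrite size_iota => h.
by rewrite -[X in (X - _)%N]h addKn; apply: eq_count.
Qed.

(** A cyclic permutation of seven places is even. *)
Lemma vol_sign_rotr1 s : size s = 7%N -> all (fun i => i < 7)%N s ->
  (vol_sign (rotr 1 s))%:~R = (vol_sign s)%:~R :> R.
Proof.
move=> ss sn; have [K <-] := vals_surj ss sn.
pose p : 'S_7 := lift_perm ord0 ord_max 1%g.
have -> : rotr 1 (vals K) = vals (K \o p).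
  apply/esym/vals_eq => [|i]; first by rewrite size_rotr size_vals.
  rewrite -[vals K](cat_take_drop 6) -[rotr 1]/(rotr (size [:: val (K ord_max)])).
  have -> : drop 6 (vals K) = [:: val (K ord_max)].
    rewrite (drop_nth 0%N) ?size_vals // drop_oversize ?size_vals //.
    by rewrite (nth_vals K ord_max).
  rewrite rotr_size_cat /p /=; case: (unliftP ord0 i) => [j ->|->] /=; last first.
    by rewrite lift_perm_id.
  rewrite lift_perm_lift perm1 nth_take; last exact: ltn_ord.
  by rewrite -(nth_vals K (lift ord_max j)) /= /bump leqNgt ltn_ord.
rewrite /vol_sign (@delta_sign_antisymmetric _ 7 (iota 0 7)) ?iota_uniq //.
by rewrite /p odd_lift_perm odd_perm1 /= expr0 mul1r.
Qed.

Lemma vol_sign_catC s1 s2 : size (s1 ++ s2) = 7%N -> all (fun i => i < 7)%N (s1 ++ s2) ->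
  (vol_sign (s1 ++ s2))%:~R = (vol_sign (s2 ++ s1))%:~R :> R.
Proof.
move=> ss sn; rewrite -(rot_size_cat s1 s2).
have : (size s1 <= 7)%N by rewrite -ss size_cat leq_addr.
elim: (size s1) => [|m IH] m7; first by rewrite rot0.
rewrite IH ?(ltnW m7) // rotS ?ss //.
rewrite -[in LHS](rotK 1 (rot m _)) vol_sign_rotr1 //; first by rewrite !size_rot ss.
by rewrite !(eq_all_r (@mem_rot _ _ _)).
Qed.

(** For fixed first indices [N] the volume form is, up to a sign, the decomposable
form on the indices not in [N]. *)
Lemma pair_volume k (b : seq nat -> R) (N : seq nat) :
  antisymmetric_fun (fun K : 'I_k -> 'I_7 => b (vals K)) ->
  (size N + k = 7)%N ->
  k`!%:R^-1 * \sum_(K : {ffun 'I_k -> 'I_7}) b (vals K) * (vol_sign (N ++ vals K))%:~R =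
  (vol_sign N)%:~R * b (co_indices N).
Proof.
move=> ab sN; rewrite /vol_sign; case E: (delta_sign (iota 0 7) N) => [c|]; last first.
  rewrite mul0r big1 ?mulr0 // => K _.
  by rewrite delta_sign_cat ?iota_uniq // E mulr0.
have [uN Nn] := delta_sign_uniq (iota_uniq 0 7) E.
have sC : size (co_indices N) = k by rewrite size_co_indices // -sN addKn.
have uC : uniq (co_indices N) by rewrite filter_uniq ?iota_uniq.
have Cn : all (fun i => i < 7)%N (co_indices N).
  by apply/allP => i; rewrite mem_filter mem_iota => /andP[_].
rewrite -(pair_coframe ab sC uC Cn) mulrCA; congr (_ * _); rewrite mulr_sumr.
apply: eq_bigr => K _; rewrite delta_sign_cat ?iota_uniq // E.
rewrite mulrCA; congr (_ * _); rewrite -intrM; congr (_%:~R).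
rewrite -/(co_indices N); case: (delta_sign _ _) => [c0|] /=; last by rewrite mulr0.
by case: c c0 {E} => [] [].
Qed.

End SignVolume.

Section PointwiseFrame.
Context {R : realType} {V : lmodType R} (g : V -> V -> R) (e : 'Z_7 -> V).
Hypothesis orth : forall i j, g (e i) (e j) = (i == j)%:R.

Lemma coframe_basis k (I K : 'I_k -> 'Z_7) : uniq (vals I) ->
  coframe g e I (e \o K) = (int_of_sign (delta_sign (vals I) (vals K)))%:~R.
Proof.
move=> uI; rewrite -(@det_delta_sign _ k) ?size_vals //; congr (\det _).
by apply/matrixP => a b; rewrite !mxE !nth_vals orth.
Qed.

Lemma volume_basis k l (I : 'I_k -> 'Z_7) (N : 'I_l -> 'Z_7) : (k + l = 7)%N ->
  volume_form g e (fun i => (codom (e \o I) ++ codom (e \o N))`_i) =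
  (vol_sign (vals I ++ vals N))%:~R.
Proof.
move=> kl; rewrite /vol_sign -(@det_delta_sign _ 7) ?size_cat ?size_vals ?iota_uniq //.
congr (\det _); apply/matrixP => a b; rewrite !mxE.
have -> : codom (e \o I) ++ codom (e \o N) = [seq e (inZp i) | i <- vals I ++ vals N].
  have F m (L : 'I_m -> 'Z_7) : codom (e \o L) = [seq e (inZp i) | i <- vals L].
    by rewrite /vals -map_comp; apply: eq_map => i /=; rewrite valZpK.
  by rewrite map_cat !F.
have b7 : (b < size (vals I ++ vals N))%N by rewrite size_cat !size_vals kl.
rewrite (nth_map 0%N) // orth nth_iota // add0n.
have : all (fun i => i < 7)%N (vals I ++ vals N) by rewrite all_cat !vals_lt.
move=> /allP/(_ _ (mem_nth 0%N b7)) /= h.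
by congr (nat_of_bool _)%:R; rewrite -val_eqE /= modn_small.
Qed.

(** The wedge product antisymmetrizes the tensor product. *)
Lemma pair_wedge k l (al : multiform V k) (be : multiform V l) (a c b : seq nat -> R) :
  (forall K, al (e \o K) = a (vals K)) -> (forall K, be (e \o K) = c (vals K)) ->
  antisymmetric_fun (fun K : 'I_(k + l) -> 'Z_7 => b (vals K)) ->
  (k + l)`!%:R^-1 * \sum_(J : {ffun 'I_(k + l) -> 'Z_7}) b (vals J) * wedge al be (e \o J) =
  (k`! * l`!)%:R^-1 * \sum_(I : {ffun 'I_k -> 'Z_7}) \sum_(K : {ffun 'I_l -> 'Z_7})
     b (vals I ++ vals K) * (a (vals I) * c (vals K)).
Proof.
move=> alE beE ab.
pose G (J : 'I_(k + l) -> 'Z_7) : R :=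
  a (vals (J \o lshift l)) * c (vals (J \o @rshift k l)).
transitivity ((k`! * l`!)%:R^-1 * \sum_(J : {ffun 'I_(k + l) -> 'Z_7}) b (vals J) * G J).
  rewrite [RHS]mulrC -[X in X * _ = _]mul1r.
  have n0 : (k + l)`!%:R != 0 :> R by rewrite pnatr_eq0 -lt0n fact_gt0.
  rewrite -[in RHS](mulKf n0 (\sum_J _)) -(sum_antisymmetrize G ab) mul1r -[RHS]mulrA.
  congr (_ * _); rewrite mulr_suml; apply: eq_bigr => J _.
  rewrite -mulrA; congr (_ * _); rewrite /wedge mulrC; congr (_ * _).
  apply: eq_bigr => s _; rewrite -mulrA; congr (_ * _); rewrite /G.
  by rewrite -alE -beE.
congr (_ * _); rewrite (sum_fcat (fun J : 'I_(k + l) -> 'Z_7 => b (vals J) * G J));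
  apply: eq_bigr => I _; apply: eq_bigr => K _.
rewrite vals_fcat /G; congr (_ * (a _ * c _)); congr vals; apply/funext => i /=.
  by rewrite fcat_l.
by rewrite fcat_r.
Qed.

(** In dimension seven a block of [k] indices and its complementary block commute
in the volume form, as one of their lengths is even. *)
Lemma hodge_basis k (al : multiform V k) (b : seq nat -> R) (N : 'I_(7 - k) -> 'Z_7) :
  (k <= 7)%N -> (forall K, al (e \o K) = b (vals K)) ->
  antisymmetric_fun (fun K : 'I_k -> 'Z_7 => b (vals K)) ->
  hodge g e al (e \o N) = (vol_sign (vals N))%:~R * b (co_indices (vals N)).
Proof.
move=> k7 alE ab; rewrite -(pair_volume ab) ?size_vals ?subnK //.
congr (_ * _); apply: eq_bigr => K _; rewrite alE volume_basis ?subnKC //.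
by rewrite (@vol_sign_catC R) // ?size_cat ?size_vals ?subnKC // all_cat !vals_lt.
Qed.

End PointwiseFrame.

(** * Structure constants and coefficients of derivatives *)

Definition sum_below (n : nat) (F : nat -> int) : int :=
  foldr (fun i z => F i + z) 0 (iota 0 n).

Lemma sum_belowE n F : sum_below n F = \sum_(i < n) F i.
Proof.
rewrite -(big_mkord predT F) /index_iota subn0 /sum_below.
by elim: (iota 0 n) => [|i s IH] /=; rewrite ?big_nil // big_cons -IH.
Qed.

Definition replace_nth (b r : nat) (s : seq nat) : seq nat := take b s ++ r :: drop b.+1 s.

Fixpoint index_lists (k : nat) : seq (seq nat) :=
  if k is k'.+1 then [seq i :: s | i <- iota 0 7, s <- index_lists k'] else [:: [::]].

Lemma vals_enumerated k (K : 'I_k -> 'Z_7) : vals K \in index_lists k.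
Proof.
have: all (fun i => i < 7)%N (vals K) by exact: vals_lt.
have: size (vals K) = k by rewrite size_vals.
move: (vals K) => s; elim: k s {K} => [|k IH] [|i s] // [sk] /andP[i7 s7].
by apply/allpairsPdep; exists i, s; rewrite mem_iota; split=> //; exact: IH.
Qed.

Lemma vals_update n k (K : 'I_k -> 'I_n) (b : 'I_k) (r : 'I_n) :
  vals [eta K with b |-> r] = replace_nth b r (vals K).
Proof.
have bk : (b < size (vals K))%N by rewrite size_vals.
apply: vals_eq; rewrite /replace_nth.
  by rewrite size_cat /= size_drop size_takel ?(ltnW bk) // size_vals;
    have := ltn_ord b; lia.
move=> i /=; rewrite nth_cat size_takel ?(ltnW bk) //.
case: ltngtP => ib.
- by rewrite nth_take // nth_vals -val_eqE /= ltn_eqF.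
- rewrite -(subnSK ib) /= nth_drop -val_eqE /= gtn_eqF //.
  by rewrite -nth_vals; congr nth; lia.
- by rewrite ib subnn /= -val_eqE /= ib eqxx.
Qed.

(** The oriented lines of the Fano plane. *)
Definition fano : seq (seq nat) :=
  [seq [:: l; (l + 1) %% 7; (l + 3) %% 7] | l <- iota 0 7]%N.

(** The coefficients are tabulated once, which keeps the verifications below
short. *)
Definition phi_table : seq (seq (seq int)) := Eval vm_compute in
  [seq [seq [seq foldr (fun P z => int_of_sign (delta_sign P [:: i; j; k]) + z) 0 fano
    | k <- iota 0 7] | j <- iota 0 7] | i <- iota 0 7].

Definition psi_table : seq (seq (seq (seq int))) := Eval vm_compute in
  [seq [seq [seq [seq
    foldr (fun P z => vol_sign (P ++ [:: i; j; k; l]) + z) 0 fano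
    | l <- iota 0 7] | k <- iota 0 7] | j <- iota 0 7] | i <- iota 0 7].

Definition phi_entry (i j k : nat) : int :=
  nth 0 (nth [::] (nth [::] phi_table i) j) k.
Definition psi_entry (i j k l : nat) : int :=
  nth 0 (nth [::] (nth [::] (nth [::] psi_table i) j) k) l.
Definition phi_coef (s : seq nat) : int :=
  phi_entry (nth 0 s 0) (nth 0 s 1) (nth 0 s 2)%N.
Definition psi_coef (s : seq nat) : int :=
  psi_entry (nth 0 s 0) (nth 0 s 1) (nth 0 s 2) (nth 0 s 3)%N.

Definition fano_sum (F : seq nat -> int) : int :=
  foldr (fun P z => F P + z) 0 fano.

Lemma phi_coef_fano : all (fun s => phi_coef s == fano_sum (fun P =>
  int_of_sign (delta_sign P s))) (index_lists 3).
Proof. by vm_compute. Qed.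

Lemma psi_coef_fano : all (fun s => psi_coef s == fano_sum (fun P => vol_sign (P ++ s)))
  (index_lists 4).
Proof. by vm_compute. Qed.

(** The coefficient of [t m a] when the form with coefficients [al], on the basis
vectors listed in [K], is derived by [y |-> y x T(e_a)]; it does not depend on
[a]. *)
Definition derivation_coef (al : seq nat -> int) (m : nat) (K : seq nat) : int :=
  sum_below (size K) (fun b => sum_below 7 (fun r =>
    let c := phi_entry (nth 0%N K b) m r in
    if c == 0 then 0 else c * al (replace_nth b r K))).

(** The coefficient of [t m a] in the exterior derivative on the basis vectors
listed in [J]. *)
Definition d_coef (al : seq nat -> int) (J : seq nat) (m a : nat) : int :=
  sum_below (size J) (fun i =>
    if nth 0%N J i == a then
      let z := derivation_coef al m (omit_nth i J) in if odd i then - z else z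
    else 0).

(** * Contraction identities *)

(** Statements about all indices are verified by evaluation, and a conditional on a
coefficient that may be zero spares the evaluation of the other factor. *)
Definition forall7 (P : nat -> bool) : bool := all P (iota 0 7).

Lemma forall7P P : forall7 P -> forall i : 'Z_7, P i.
Proof. by move=> /allP h i; apply: h; rewrite mem_iota; exact: (ltn_ord i). Qed.

Lemma psi_coef_star : all (fun s => psi_coef s == vol_sign s * phi_coef (co_indices s))
  (index_lists 4).
Proof. by vm_compute. Qed.

Definition dphi_psi_coef (m a : nat) : int :=
  fano_sum (fun P => vol_sign P * d_coef phi_coef (co_indices P) m a).

(** The pairing of the derivative of phi with [e_i /\ (e_j _| psi)]: the four-form is
the sum, over the lines [P], of the volume form with [P] in the first three places,
so the pairing evaluates on [i] and the indices outside [P] and [j]. *)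
Definition dphi_wedge_coef (i j m a : nat) : int :=
  fano_sum (fun P => let N := P ++ [:: j] in let s := vol_sign N in
    if s == 0 then 0 else s * d_coef phi_coef (i :: co_indices N) m a).

(** Two stars are applied here, whence the two complements. *)
Definition pd_coef (j m a : nat) : int :=
  fano_sum (fun P => let N := P ++ [:: j] in let s := vol_sign N in
    if s == 0 then 0 else s * (vol_sign (co_indices N) * d_coef phi_coef (co_indices
      (co_indices N)) m a)).

Lemma dphi_psi_coefE : forall7 (fun m => forall7 (fun a =>
  dphi_psi_coef m a == 12 * (m == a)%:Z)).
Proof. by vm_compute. Qed.

Lemma dphi_wedge_coefE : forall7 (fun i => forall7 (fun j => forall7 (fun m =>
  forall7 (fun a =>
  dphi_wedge_coef i j m a + dphi_wedge_coef j i m a ==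
  6 * (((i == m) && (j == a))%:Z + ((j == m) && (i == a))%:Z) +
  12 * (i == j)%:Z * (m == a)%:Z)))).
Proof. by vm_compute. Qed.

Lemma pd_coefE : forall7 (fun j => forall7 (fun m => forall7 (fun a =>
  pd_coef j m a == 6 * phi_entry j m a))).
Proof. by vm_compute. Qed.

Lemma dpsi_star_coefE : forall7 (fun i => forall7 (fun j => forall7 (fun m =>
  forall7 (fun a =>
  vol_sign [:: i; j] * d_coef psi_coef (co_indices [:: i; j]) m a ==
    - 3 * psi_entry i j a m)))).
Proof. by vm_compute. Qed.

Lemma star_psi_coefE : forall7 (fun i => forall7 (fun j => forall7 (fun a =>
  vol_sign [:: i; j; a] * psi_coef (co_indices [:: i; j; a]) == phi_entry i j a))).
Proof. by vm_compute. Qed.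

(** The composition rule of the cross product: [u x (v x w)] is determined by the
metric and the four-form. *)
Lemma phi_phi_contraction : forall7 (fun i => forall7 (fun j => forall7 (fun m =>
  forall7 (fun a =>
  sum_below 7 (fun l => phi_entry i j l * phi_entry l m a) ==
  ((i == m) && (j == a))%:Z - ((j == m) && (i == a))%:Z - psi_entry i j m a)))).
Proof. by vm_compute. Qed.

Lemma psi_entry_sym : forall7 (fun i => forall7 (fun j => forall7 (fun m =>
  forall7 (fun a =>
  (psi_entry j i m a == - psi_entry i j m a) && (psi_entry i j a m ==
    - psi_entry i j m a))))).
Proof. by vm_compute. Qed.

Lemma phi_entry_sym : forall7 (fun i => forall7 (fun j => forall7 (fun k =>
  (phi_entry j i k == - phi_entry i j k) && (phi_entry j k i == phi_entry i j k)))).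
Proof. by vm_compute. Qed.

(** The coefficients of six times the component in g2, which combines a skew
endomorphism with its contraction by the four-form. *)
Definition g2_part_coef (i j m a : nat) : int :=
  2 * (((i == m) && (j == a))%:Z - ((j == m) && (i == a))%:Z) + psi_entry i j m a.

(** The action of that component on phi vanishes. *)
Lemma g2_part_coef_g2 : forall7 (fun i => forall7 (fun j => forall7 (fun l =>
  forall7 (fun m => forall7 (fun a =>
   sum_below 7 (fun k =>
   (if phi_entry i j k == 0 then 0 else phi_entry i j k * g2_part_coef k l m a) +
   (if phi_entry k j l == 0 then 0 else phi_entry k j l * g2_part_coef k i m a) +
   (if phi_entry i k l == 0 then 0 else phi_entry i k l * g2_part_coef k j m a))
   == 0))))).
Proof. by vm_compute. Qed.

Lemma psi_phi_contraction : forall7 (fun n => forall7 (fun k => forall7 (fun l =>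
  sum_below 7 (fun i => sum_below 7 (fun j =>
   psi_entry n i j l * phi_entry i j k + psi_entry n l i j * phi_entry k i j +
     psi_entry n i l j * phi_entry i k j))
   == 12 * phi_entry n k l))).
Proof. by vm_compute. Qed.

(** * Combinations of the entries of the torsion *)

Section MoreSigns.
Context {R : realType}.

Lemma vol_sign_antisymmetric_r l s : (size s + l = 7)%N ->
  antisymmetric_fun (fun N : 'I_l -> 'I_7 => (vol_sign (s ++ vals N))%:~R : R).
Proof.
move=> sl v p; rewrite /vol_sign !delta_sign_cat ?iota_uniq //.
case E: (delta_sign (iota 0 7) s) => [b|]; last by rewrite mulr0.
have [us sn] := delta_sign_uniq (iota_uniq 0 7) E.
have sC : size (co_indices s) = l by rewrite size_co_indices // -sl addKn.
have uC : uniq (co_indices s) by rewrite filter_uniq ?iota_uniq.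
have sgi_addb c : int_of_sign (omap (addb b) c) = (-1) ^+ b * int_of_sign c.
  by case: c => [c|]; rewrite ?mulr0 //; case: b c {E} => [] [].
rewrite -/(co_indices s) !sgi_addb !intrM (delta_sign_antisymmetric sC uC v p).
by rewrite mulrCA.
Qed.

Lemma vol_sign_antisymmetric_l l s : (l + size s = 7)%N -> all (fun i => i < 7)%N s ->
  antisymmetric_fun (fun N : 'I_l -> 'I_7 => (vol_sign (vals N ++ s))%:~R : R).
Proof.
move=> sl sn v p.
have C (N : 'I_l -> 'I_7) : (vol_sign (vals N ++ s))%:~R =
  (vol_sign (s ++ vals N))%:~R :> R.
  by rewrite vol_sign_catC // ?size_cat ?size_vals // all_cat vals_lt.
by rewrite !C vol_sign_antisymmetric_r // addnC.
Qed.

(** By [pair_volume] the function is a pairing with the volume form, which is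
antisymmetric in the remaining places. *)
Lemma star_antisymmetric k l (b : seq nat -> R) : (k + l = 7)%N ->
  antisymmetric_fun (fun K : 'I_k -> 'I_7 => b (vals K)) ->
  antisymmetric_fun (fun N : 'I_l -> 'I_7 =>
    (vol_sign (vals N))%:~R * b (co_indices (vals N))).
Proof.
move=> kl ab v p; rewrite -!(pair_volume ab) ?size_vals; try by rewrite addnC.
rewrite mulrCA; congr (_ * _); rewrite mulr_sumr; apply: eq_bigr => K _.
rewrite (@vol_sign_antisymmetric_l l (vals K)) ?size_vals ?vals_lt 1?addnC //.
by rewrite mulrCA.
Qed.

(** A combination of the entries of [t] with integer coefficients; an identity
between such combinations reduces to one between integers. *)
Definition int_comb (t : 'Z_7 -> 'Z_7 -> R) (c : nat -> nat -> int) : R :=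
  \sum_(m : 'Z_7) \sum_(a : 'Z_7) t m a * (c m a)%:~R.

Implicit Types (t : 'Z_7 -> 'Z_7 -> R) (c : nat -> nat -> int).

Lemma eq_int_comb t c c' : (forall m a : 'Z_7, c m a = c' m a) -> int_comb t c =
  int_comb t c'.
Proof. by move=> h; apply: eq_bigr => m _; apply: eq_bigr => a _; rewrite h. Qed.

Lemma int_combD t c c' : int_comb t (fun m a => c m a + c' m a) = int_comb t c +
  int_comb t c'.
Proof.
rewrite /int_comb -big_split; apply: eq_bigr => m _; rewrite -big_split.
by apply: eq_bigr => a _; rewrite intrD mulrDr.
Qed.

Lemma int_combZ t z c : int_comb t (fun m a => z * c m a) = z%:~R * int_comb t c.
Proof.
rewrite /int_comb mulr_sumr; apply: eq_bigr => m _; rewrite mulr_sumr.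
by apply: eq_bigr => a _; rewrite intrM mulrCA.
Qed.

Lemma int_combN t c : int_comb t (fun m a => - c m a) = - int_comb t c.
Proof. by rewrite -mulN1r -[-1]/((-1)%:~R) -int_combZ; apply: eq_int_comb =>
  m a; rewrite mulN1r. Qed.

Lemma int_comb_sum (I : Type) (r : seq I) (F : I -> nat -> nat -> int) t :
  int_comb t (fun m a => \sum_(i <- r) F i m a) = \sum_(i <- r) int_comb t (F i).
Proof.
elim: r => [|i r IH].
  rewrite big_nil /int_comb big1 // => m _; rewrite big1 // => a _.
  by rewrite big_nil mulr0.
rewrite big_cons -IH -int_combD; apply: eq_int_comb => m a; by rewrite big_cons.
Qed.

Lemma int_comb_entry t (i j : 'Z_7) :
  int_comb t (fun m a => ((val i == m) && (val j == a))%:Z) = t i j.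
Proof.
rewrite /int_comb (bigD1 i) //= (bigD1 j) //= !eqxx mulr1 big1 ?addr0 => [|a aj].
  rewrite big1 ?addr0 // => m mi; rewrite big1 // => a _.
  by rewrite [_ == _ :> nat]eq_sym val_eqE (negbTE mi) mulr0.
by rewrite [X in _ && X]eq_sym val_eqE (negbTE aj) andbF mulr0.
Qed.

Lemma int_comb_trace t : int_comb t (fun m a => (m == a)%:Z) = \sum_i t i i.
Proof.
apply: eq_bigr => i _; rewrite (bigD1 i) //= eqxx mulr1 big1 ?addr0 // => a ai.
by rewrite eq_sym val_eqE (negbTE ai) mulr0.
Qed.

End MoreSigns.

Section DerivativeComponents.
Context {R : realType} {V : lmodType R} (e : 'Z_7 -> V) (t : 'Z_7 -> 'Z_7 -> R).
Variables (B : V -> V -> V) (k : nat) (al : multiform V k) (alZ : seq nat -> int).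
Hypothesis alal : alternating_form al.
Hypothesis alE : forall K, al (e \o K) = (alZ (vals K))%:~R.
Hypothesis BE : forall a b,
  B (e a) (e b) = \sum_(m : 'Z_7) \sum_(r : 'Z_7) (t m a * (phi_entry b m r)%:~R) *: e r.

Lemma alternating_slot_sum (I : Type) (s : seq I) (c : I -> R) (x : I -> V) v (b : 'I_k) :
  al [eta v with b |-> \sum_(i <- s) c i *: x i] =
  \sum_(i <- s) c i * al [eta v with b |-> x i].
Proof.
elim: s => [|i s IH]; last by rewrite !big_cons alal.1 IH.
rewrite !big_nil; have := alal.1 v b (-1) 0 0; rewrite scaler0 addr0 => ->; lra.
Qed.

Lemma derivation_components (a : 'Z_7) (K : 'I_k -> 'Z_7) :
  \sum_(b < k) al [eta e \o K with b |-> B (e a) (e (K b))] =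
  \sum_(m : 'Z_7) t m a * (derivation_coef alZ m (vals K))%:~R.
Proof.
transitivity (\sum_(b < k) \sum_(m : 'Z_7) t m a *
    \sum_(r : 'Z_7) (phi_entry (K b) m r * alZ (replace_nth b r (vals K)))%:~R).
  apply: eq_bigr => b _; rewrite BE.
  have -> : \sum_(m : 'Z_7) \sum_(r : 'Z_7) (t m a * (phi_entry (K b) m r)%:~R) *: e r =
      \sum_(m : 'Z_7) 1 *: \sum_(r : 'Z_7) (t m a * (phi_entry (K b) m r)%:~R) *: e r.
    by apply: eq_bigr => m _; rewrite scale1r.
  rewrite alternating_slot_sum; apply: eq_bigr => m _.
  rewrite mul1r alternating_slot_sum mulr_sumr; apply: eq_bigr => r _.
  have -> : al [eta e \o K with b |-> e r] = al (e \o [eta K with b |-> r]).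
    by congr al; apply/funext => i /=; case: eqP.
  by rewrite alE vals_update intrM mulrA.
rewrite exchange_big; apply: eq_bigr => m _; rewrite -mulr_sumr; congr (_ * _).
rewrite /derivation_coef size_vals sum_belowE rmorph_sum; apply: eq_bigr => b _.
rewrite nth_vals sum_belowE rmorph_sum; apply: eq_bigr => r _.
by case: eqP => // ->; rewrite mul0r.
Qed.

(** Permuting the arguments permutes the terms. *)
Lemma derivation_antisymmetric (a : 'Z_7) :
  antisymmetric_fun (fun K : 'I_k -> 'Z_7 =>
    \sum_(b < k) al [eta e \o K with b |-> B (e a) (e (K b))]).
Proof.
move=> v s; rewrite [in RHS](reindex_inj (@perm_inj _ s)) mulr_sumr.
apply: eq_bigr => b _; rewrite -(alternating_antisymmetric alal).
by congr al; apply/funext => i /=; rewrite (inj_eq perm_inj).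
Qed.

Lemma d_components (J : 'I_k.+1 -> 'Z_7) :
  \sum_(i < k.+1) (-1) ^+ i * \sum_(b < k)
    al [eta e \o (J \o lift i) with b |-> B (e (J i)) (e (J (lift i b)))] =
  int_comb t (d_coef alZ (vals J)).
Proof.
under eq_bigr => i _ do rewrite (derivation_components (J i) (J \o lift i)).
rewrite /int_comb; under eq_bigr do rewrite mulr_sumr.
rewrite exchange_big; apply: eq_bigr => m _ /=.
under [RHS]eq_bigr do rewrite /d_coef sum_belowE size_vals rmorph_sum mulr_sumr.
rewrite exchange_big /=; apply: eq_bigr => i _.
rewrite (bigD1 (J i)) //= big1 ?addr0 => [|a aJ]; last first.
  by rewrite nth_vals eq_sym val_eqE (negbTE aJ) mulr0.
rewrite nth_vals eqxx vals_lift -[(-1) ^+ i]signr_odd.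
by case: odd; rewrite ?expr0 ?mul1r // expr1 mulN1r rmorphN mulrN.
Qed.

Lemma d_components_antisymmetric :
  antisymmetric_fun (fun J : 'I_k.+1 -> 'Z_7 => int_comb t (d_coef alZ (vals J))).
Proof.
move=> v s; rewrite -!d_components.
exact: (alternation_antisymmetric derivation_antisymmetric).
Qed.

End DerivativeComponents.

(** * Exterior derivatives and star in components *)

Lemma fano_sumE F : fano_sum F = \sum_(P <- fano) F P.
Proof. by rewrite /fano_sum;
  elim: fano => [|P s IH] /=; rewrite ?big_nil // big_cons IH. Qed.

Lemma fano_triple P : P \in fano -> [/\ size P = 3, uniq P & all (fun i => i < 7)%N P]%N.
Proof.
have : all (fun P => [&& size P == 3, uniq P & all (fun i => i < 7) P]%N) fano by [].
by move=> /allP h /h /and3P[/eqP].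
Qed.

Section FormComponents.
Context {R : realType} {V : lmodType R} (g : V -> V -> R) (e : 'Z_7 -> V).
Hypothesis orth : forall i j, g (e i) (e j) = (i == j)%:R.
Variable phi : multiform V 3.
Hypothesis phiE : forall v, phi v = cayley_form g e v.
Let psi := hodge g e phi.

Lemma check_list k (p : seq nat -> bool) : all p (index_lists k) ->
  forall K : 'I_k -> 'Z_7, p (vals K).
Proof. by move=> /allP h K; apply/h/vals_enumerated. Qed.

Lemma phi_components K : phi (e \o K) = (phi_coef (vals K))%:~R.
Proof.
rewrite phiE (eqP (check_list phi_coef_fano K)) fano_sumE rmorph_sum big_map.
rewrite -[iota 0 7]/(index_iota 0 7) big_mkord; apply: eq_bigr => l _.
have nl : vals (tnth [tuple l; l + 1; l + 3]) =
    [:: val l; (val l + 1) %% 7; (val l + 3) %% 7]%N.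
  by apply: vals_eq => // i; case: i => [[|[|[|]]]].
rewrite (coframe_basis orth) nl //.
by case: l {nl} => [[|[|[|[|[|[|[|]]]]]]]].
Qed.

Lemma phi_antisymmetric :
  antisymmetric_fun (fun K : 'I_3 -> 'Z_7 => (phi_coef (vals K))%:~R : R).
Proof.
have E (K : 'I_3 -> 'Z_7) : (phi_coef (vals K))%:~R = \sum_(P <- fano)
  (int_of_sign (delta_sign P (vals K)))%:~R :> R.
  by rewrite (eqP (check_list phi_coef_fano K)) fano_sumE rmorph_sum.
move=> v s; rewrite !E mulr_sumr !big_seq; apply: eq_bigr => P /fano_triple[sP uP _].
exact: delta_sign_antisymmetric.
Qed.

Lemma psi_components N : psi (e \o N) = (psi_coef (vals N))%:~R.
Proof.
transitivity ((vol_sign (vals N))%:~R * (phi_coef (co_indices (vals N)))%:~R : R).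
  exact: (@hodge_basis _ _ _ _ orth _ _ (fun s => (phi_coef s)%:~R) N _
    phi_components phi_antisymmetric).
by rewrite -intrM -(eqP (check_list psi_coef_star N)).
Qed.

Lemma psi_antisymmetric :
  antisymmetric_fun (fun K : 'I_4 -> 'Z_7 => (psi_coef (vals K))%:~R : R).
Proof.
move=> v s; have := @star_antisymmetric R 3 4 (fun s =>
  (phi_coef s)%:~R) erefl phi_antisymmetric v s.
by rewrite -!intrM -!(eqP (check_list psi_coef_star _)).
Qed.

(** The four-form is the sum, over the Fano lines, of the volume form with the line
in the first three places. *)
Lemma pair_psi k (b : seq nat -> R) (N : seq nat) :
  antisymmetric_fun (fun K : 'I_k -> 'I_7 => b (vals K)) -> (size N + k = 4)%N ->
  all (fun i => i < 7)%N N ->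
  k`!%:R^-1 * \sum_(K : {ffun 'I_k -> 'I_7}) b (vals K) * (psi_coef (N ++ vals K))%:~R =
  \sum_(P <- fano) (vol_sign (P ++ N))%:~R * b (co_indices (P ++ N)).
Proof.
move=> ab sN Nn; rewrite [RHS]big_seq.
under [RHS]eq_bigr => P Pf.
  have [sP _ _] := fano_triple Pf.
  rewrite -(pair_volume ab) ?size_cat ?sP -?addnA ?sN //.
over.
rewrite -big_seq -mulr_sumr; congr (_ * _); rewrite exchange_big /=.
apply: eq_bigr => K _; rewrite -mulr_sumr; congr (_ * _).
have [L LE] : exists L : 'I_4 -> 'Z_7, vals L = N ++ vals K.
  by apply: vals_surj; rewrite ?size_cat ?size_vals ?sN // all_cat Nn vals_lt.
rewrite -LE (eqP (check_list psi_coef_fano L)) fano_sumE rmorph_sum LE.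
by apply: eq_bigr => P _; rewrite catA.
Qed.

Lemma sum_vals1 (F : seq nat -> R) :
  \sum_(I : {ffun 'I_1 -> 'Z_7}) F (vals I) = \sum_(a : 'Z_7) F [:: val a].
Proof.
rewrite (sum_ffun1 (fun I : 'I_1 -> 'Z_7 => F (vals I))); apply: eq_bigr => a _.
by congr F; apply: vals_eq => // i; rewrite (ord1 i).
Qed.

Let dual i := coframe g e (tnth [tuple i]).

Let delta (i : 'Z_7) (s : seq nat) : R := (val i == nth 0%N s 0)%:R.

Lemma dual_components (i : 'Z_7) K : dual i (e \o K) = delta i (vals K).
Proof.
rewrite /delta /dual /coframe det_mx11 !mxE (nth_vals K ord0) val_eqE.
exact: orth.
Qed.

Lemma sum_delta (F : 'Z_7 -> R) (i : 'Z_7) :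
  \sum_(a : 'Z_7) F a * (val i == val a)%:R = F i.
Proof.
rewrite (bigD1 i) //= eqxx mulr1 big1 ?addr0 // => a ai.
by rewrite val_eqE eq_sym (negbTE ai) mulr0.
Qed.

Lemma star_dual2_components (i j : 'Z_7) N :
  hodge g e (wedge (dual i) (dual j)) (e \o N) =
  (vol_sign ([:: val i; val j] ++ vals N))%:~R.
Proof.
rewrite /hodge.
under eq_bigr do rewrite (@volume_basis _ _ _ _ orth (1 + 1) (7 - (1 + 1)) _ N erefl) mulrC.
rewrite (pair_wedge (a := delta i) (c := delta j) (b := fun s =>
  (vol_sign (s ++ vals N))%:~R)
  (dual_components i) (dual_components j)); last first.
  by apply: vol_sign_antisymmetric_l; rewrite ?size_vals ?vals_lt.
rewrite invr1 mul1r.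
rewrite (sum_vals1 (fun s => \sum_(K : {ffun 'I_1 -> 'Z_7})
  (vol_sign ((s ++ vals K) ++ vals N))%:~R
  * (delta i s * delta j (vals K)))).
rewrite -[RHS](sum_delta (fun a => (vol_sign ([:: val a; val j] ++ vals N))%:~R) i).
apply: eq_bigr => a _.
rewrite (sum_vals1 (fun s => (vol_sign (([:: val a] ++ s) ++ vals N))%:~R
  * (delta i [:: val a] * delta j s))) /=.
rewrite -(sum_delta (fun c => (vol_sign ([:: val a; val c] ++ vals N))%:~R) j) mulr_suml.
by apply: eq_bigr => c _; rewrite mulrA mulrAC.
Qed.

(** The wedge product with a covector is adjoint to the interior product. *)
Lemma wedge_dual_inner k (al : multiform V k.+1) (be : multiform V k) (a b : seq nat -> R)
    (i : 'Z_7) :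
  (forall K, al (e \o K) = a (vals K)) -> (forall K, be (e \o K) = b (vals K)) ->
  antisymmetric_fun (fun K : 'I_k.+1 -> 'Z_7 => a (vals K)) ->
  form_inner e al (wedge (dual i) be : multiform V k.+1) =
  k`!%:R^-1 * \sum_(K : {ffun 'I_k -> 'Z_7}) a (val i :: vals K) * b (vals K).
Proof.
move=> alE beE aa; rewrite /form_inner.
under eq_bigr do rewrite alE.
rewrite (@pair_wedge _ _ _ 1 k _ _ (delta i) b a (dual_components i) beE aa) mul1n;
  congr (_ * _).
rewrite (sum_vals1 (fun s => \sum_(K : {ffun 'I_k -> 'Z_7}) a (s ++ vals K)
  * (delta i s * b (vals K)))).
rewrite -(sum_delta (fun c => \sum_(K : {ffun 'I_k -> 'Z_7}) a (val c ::
  vals K) * b (vals K)) i).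
apply: eq_bigr => c _; rewrite mulr_suml; apply: eq_bigr => K _ /=; ring.
Qed.

Lemma form_innerD k (al be be' : multiform V k) :
  form_inner e al (be + be') = form_inner e al be + form_inner e al be'.
Proof.
rewrite /form_inner -mulrDr -big_split; congr (_ * _).
by apply: eq_bigr => I _; rewrite /= -mulrDr.
Qed.

Lemma form_innerZ k c (al be : multiform V k) :
  form_inner e al (c *: be) = c * form_inner e al be.
Proof.
rewrite /form_inner mulrCA; congr (_ * _); rewrite mulr_sumr.
by apply: eq_bigr => I _; rewrite mulrCA.
Qed.

Lemma form_innerC k (al be : multiform V k) : form_inner e al be = form_inner e be al.
Proof. by congr (_ * _); apply: eq_bigr => I _; rewrite mulrC. Qed.

Section Derivatives.
Variables (t : 'Z_7 -> 'Z_7 -> R) (dphi : multiform V 4) (dpsi : multiform V 5).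
Hypothesis dphiE : forall J, dphi (e \o J) = int_comb t (d_coef phi_coef (vals J)).
Hypothesis dphi_anti :
  antisymmetric_fun (fun J : 'I_4 -> 'Z_7 => int_comb t (d_coef phi_coef (vals J))).
Hypothesis dpsiE : forall J, dpsi (e \o J) = int_comb t (d_coef psi_coef (vals J)).
Hypothesis dpsi_anti :
  antisymmetric_fun (fun J : 'I_5 -> 'Z_7 => int_comb t (d_coef psi_coef (vals J))).

Lemma int_comb_fano_sum (c : seq nat -> int) (D : seq nat -> nat -> nat -> int) :
  int_comb t (fun m a => fano_sum (fun P => c P * D P m a)) =
  \sum_(P <- fano) (c P)%:~R * int_comb t (D P).
Proof.
rewrite -(eq_bigr _ (fun P _ => int_combZ t (c P) (D P))) -int_comb_sum.
by apply: eq_int_comb => m a; rewrite fano_sumE.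
Qed.

Lemma dphi_psi : form_inner e dphi psi = 12 * \sum_i t i i.
Proof.
rewrite /form_inner; under eq_bigr do rewrite dphiE psi_components.
rewrite (@pair_psi 4 (fun s => int_comb t (d_coef phi_coef s)) [::] dphi_anti) //.
under eq_bigr do rewrite cats0.
rewrite -(int_comb_fano_sum vol_sign (fun P =>
  d_coef phi_coef (co_indices P))) -int_comb_trace -[12]/(12%:~R) -int_combZ.
by apply: eq_int_comb => m a; apply/eqP; exact: (forall7P (forall7P dphi_psi_coefE m) a).
Qed.

Lemma dphi_wedge (i j : 'Z_7) :
  form_inner e dphi (wedge (dual i) (interior_product (e j) psi) : multiform V 4) =
  int_comb t (dphi_wedge_coef i j).
Proof.
have ipE (K : 'I_3 -> 'Z_7) : interior_product (e j) psi (e \o K) = (psi_coef (val j ::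
  vals K))%:~R.
  rewrite -vals_vcons -psi_components; congr psi; apply/funext => l /=.
  by rewrite /vcons; case: unlift.
rewrite (@wedge_dual_inner 3 _ _ (fun s => int_comb t (d_coef phi_coef s)) (fun s =>
  (psi_coef (val j :: s))%:~R) i dphiE ipE dphi_anti).
rewrite (pair_psi (k := 3) (b := fun s => int_comb t (d_coef phi_coef (val i :: s)))
  (N := [:: val j])) //.
- rewrite -(int_comb_fano_sum (fun P => vol_sign (P ++ [:: val j])) (fun P =>
  d_coef phi_coef (val i :: co_indices (P ++ [:: val j])))).
  apply: eq_int_comb => m a; rewrite /dphi_wedge_coef !fano_sumE; apply: eq_bigr => P _ /=.
  by case: eqP => // ->; rewrite mul0r.
- move=> v s; rewrite -!vals_vcons.
  have -> : vcons i (v \o s) = vcons i v \o lift_perm ord0 ord0 s.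
    apply/funext => l; case: (unliftP ord0 l) => [l' ->|->] /=.
      by rewrite lift_perm_lift !vconsS.
    by rewrite lift_perm_id !vcons0.
  by rewrite dphi_anti odd_lift_perm.
- by rewrite /= ltn_ord.
Qed.

Let pd : multiform V 1 := hodge g e (wedge (hodge g e dphi) phi).

(** One factor 3! serves to evaluate on the lines of phi, the other to pair the star
of the derivative with the volume form. *)
Lemma pd_components (j : 'Z_7) K : K ord0 = j -> pd (e \o K) = 6 * int_comb t (phi_entry j).
Proof.
move=> Kj; have NE : vals K = [:: val j] by apply: vals_eq => // i; rewrite (ord1 i) Kj.
have sdE (I : 'I_(7 - 4) -> 'Z_7) :=
  @hodge_basis _ _ _ _ orth 4 dphi (fun s =>
    int_comb t (d_coef phi_coef s)) I isT dphiE dphi_anti.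
rewrite /pd /hodge.
under eq_bigr do rewrite (@volume_basis _ _ _ _ orth (7 - 4 + 3) (7 - (7 - 4 +
  3)) _ K erefl) mulrC.
rewrite (@pair_wedge _ _ e 3 3 _ phi (fun s =>
  (vol_sign s)%:~R * int_comb t (d_coef phi_coef (co_indices s)))
  (fun s => (phi_coef s)%:~R) (fun s =>
    (vol_sign (s ++ vals K))%:~R) sdE phi_components); last first.
  by apply: vol_sign_antisymmetric_l; rewrite ?size_vals ?vals_lt.
pose a s := (vol_sign s)%:~R * int_comb t (d_coef phi_coef (co_indices s)).
have aa : antisymmetric_fun (fun I : 'I_3 -> 'I_7 => a (vals I)).
  exact: (@star_antisymmetric R 4 3 (fun s =>
    int_comb t (d_coef phi_coef s)) erefl dphi_anti).
transitivity (\sum_(P <- fano) 3`!%:R^-1 *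
    \sum_(I : {ffun 'I_3 -> 'Z_7}) a (vals I) * (vol_sign ((P ++ vals K) ++ vals I))%:~R).
  rewrite natrM invfM -mulrA -mulr_sumr; congr (_ * _).
  rewrite [RHS]exchange_big mulr_sumr /=; apply: eq_bigr => I _.
  rewrite -[RHS]mulr_sumr; under eq_bigr do rewrite mulrCA.
  rewrite -[X in _ * X = _]mulr_sumr mulrCA; congr (_ * _); rewrite mulr_sumr.
  under eq_bigr => L _.
    rewrite (eqP (check_list phi_coef_fano L)) fano_sumE rmorph_sum mulr_sumr mulr_sumr;
      over.
  rewrite exchange_big /= !big_seq; apply: eq_bigr => P /fano_triple[sP uP Pn].
  rewrite -mulr_sumr.
  have C (L : seq nat) : size L = 3%N -> all (fun i => i < 7)%N L ->
      (vol_sign ((vals I ++ L) ++ vals K))%:~R =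
        (vol_sign (L ++ (vals K ++ vals I)))%:~R :> R.
    move=> sL Ln; rewrite -catA vol_sign_catC ?catA // ?size_cat ?size_vals ?sL //.
    by rewrite !all_cat !vals_lt Ln.
  rewrite -catA -C //.
  rewrite -[RHS](@pair_coframe R 7 3 (fun s =>
    (vol_sign ((vals I ++ s) ++ vals K))%:~R) P) //.
  move=> v s; rewrite !C ?size_vals ?vals_lt //.
  by apply: vol_sign_antisymmetric_l; rewrite ?size_cat ?size_vals // all_cat !vals_lt.
rewrite big_seq; under eq_bigr => P Pf.
  have [sP _ _] := fano_triple Pf.
  rewrite (pair_volume aa) ?size_cat ?size_vals ?sP // NE; over.
rewrite -big_seq -[6]/(6%:~R) -int_combZ.
transitivity (int_comb t (pd_coef j)); last first.
  by apply: eq_int_comb => m c; apply/eqP;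
    exact: (forall7P (forall7P (forall7P pd_coefE j) m) c).
rewrite /a; under eq_bigr do rewrite -int_combZ.
rewrite -(int_comb_fano_sum (fun P => vol_sign (P ++ [:: val j])) (fun P m c =>
  vol_sign (co_indices (P ++ [::
    val j])) * d_coef phi_coef (co_indices (co_indices (P ++ [:: val j]))) m c)).
apply: eq_int_comb => m c; rewrite /pd_coef !fano_sumE; apply: eq_bigr => P _ /=.
by case: eqP => // ->; rewrite mul0r.
Qed.

Lemma dpsi_star (i j : 'Z_7) :
  form_inner e dpsi (hodge g e (wedge (dual i) (dual j))) =
  - 3 * int_comb t (fun m a => psi_entry i j a m).
Proof.
rewrite /form_inner.
under eq_bigr do rewrite dpsiE star_dual2_components.
rewrite (@pair_volume _ 5 (fun s => int_comb t (d_coef psi_coef s)) [::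
  val i; val j] dpsi_anti) //.
rewrite -int_combZ -[- 3]/((- 3)%:~R) -int_combZ; apply: eq_int_comb => m a; apply/eqP.
exact: (forall7P (forall7P (forall7P (forall7P dpsi_star_coefE i) j) m) a).
Qed.

Lemma pd_psi_star (i j : 'Z_7) :
  form_inner e (wedge pd psi : multiform V 5) (hodge g e (wedge (dual i) (dual j))) =
  \sum_(l : 'Z_7) 6 * int_comb t (phi_entry l) * (phi_entry i j l)%:~R.
Proof.
rewrite form_innerC /form_inner.
under eq_bigr do rewrite star_dual2_components.
have pdE (K : 'I_1 -> 'Z_7) : pd (e \o K) = 6 * int_comb t (phi_entry (nth 0%N (vals K) 0)).
  by rewrite (nth_vals K ord0) (pd_components (j := K ord0)).
rewrite (@pair_wedge _ _ e 1 4 pd psi (fun s => 6 * int_comb t (phi_entry (nth 0%N s 0)))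
  (fun s => (psi_coef s)%:~R) (fun s => (vol_sign ([::
    val i; val j] ++ s))%:~R) pdE psi_components);
  last exact: vol_sign_antisymmetric_r.
rewrite mul1n mulr_sumr.
rewrite (sum_vals1 (fun s => 4`!%:R^-1 * \sum_(K : {ffun 'I_4 -> 'Z_7})
  (vol_sign ([:: val i; val j] ++ (s ++ vals K)))%:~R *
  (6 * int_comb t (phi_entry (nth 0%N s 0)) * (psi_coef (vals K))%:~R))).
apply: eq_bigr => l _.
have <- := eqP (forall7P (forall7P (forall7P star_psi_coefE i) j) l).
rewrite intrM -(@pair_volume _ 4 (fun s => (psi_coef s)%:~R) [::
  val i; val j; val l] psi_antisymmetric) //.
rewrite -[nth 0%N [:: val l] 0]/(val l); move: (int_comb t (phi_entry (val l))) => L.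
rewrite [RHS]mulrCA; congr (_ * _); rewrite mulr_sumr; apply: eq_bigr => K _ /=.
by rewrite mulrCA; congr (_ * _); rewrite mulrC.
Qed.

End Derivatives.
End FormComponents.

(** * Endomorphisms and their four components *)

Section Endomorphisms.
Context {R : realType} {V : lmodType R} (g : V -> V -> R).
Hypothesis gC : forall x y, g x y = g y x.
Hypothesis gL : forall a x y z, g (a *: x + y) z = a * g x z + g y z.

Lemma g0l z : g 0 z = 0.
Proof. have := gL (-1) 0 0 z; rewrite scaler0 addr0 => ->; lra. Qed.

Lemma gDl x y z : g (x + y) z = g x z + g y z.
Proof. by rewrite -[x]scale1r gL mul1r scale1r. Qed.

Lemma gZl a x z : g (a *: x) z = a * g x z.
Proof. by rewrite -[a *: x]addr0 gL g0l addr0. Qed.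

Lemma gNl x z : g (- x) z = - g x z.
Proof. by rewrite -scaleN1r gZl mulN1r. Qed.

Lemma gDr x y z : g z (x + y) = g z x + g z y.
Proof. by rewrite gC gDl !(gC _ z). Qed.

Lemma gZr a x z : g z (a *: x) = a * g z x.
Proof. by rewrite gC gZl (gC _ z). Qed.

Lemma gNr x z : g z (- x) = - g z x.
Proof. by rewrite gC gNl (gC _ z). Qed.

Lemma g_suml I (r : seq I) (P : pred I) (F : I -> V) z :
  g (\sum_(i <- r | P i) F i) z = \sum_(i <- r | P i) g (F i) z.
Proof. by elim/big_rec2: _ => [|i x y _ <-]; rewrite ?g0l ?gDl. Qed.

Lemma g_sumr I (r : seq I) (P : pred I) (F : I -> V) z :
  g z (\sum_(i <- r | P i) F i) = \sum_(i <- r | P i) g z (F i).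
Proof. by rewrite gC g_suml; apply: eq_bigr => i _; rewrite gC. Qed.

Section Basis.
Variable e : 'Z_7 -> V.
Hypothesis ortho : orthonormal_basis g e.
Let orth := ortho.1.

Lemma frame_coordinates v : \sum_i g v (e i) *: e i = v.
Proof.
have [c ->] := ortho.2 v; apply: eq_bigr => i _; congr (_ *: _).
rewrite g_suml (bigD1 i) //= gZl orth eqxx mulr1 big1 ?addr0 // => j ji.
by rewrite gZl orth (negbTE ji) mulr0.
Qed.

Lemma frame_ext x y : (forall i, g x (e i) = g y (e i)) -> x = y.
Proof.
move=> h; rewrite -[x]frame_coordinates -[y]frame_coordinates.
by apply: eq_bigr => i _; rewrite h.
Qed.

Lemma parseval x y : \sum_i g x (e i) * g y (e i) = g x y.
Proof.
rewrite -[in RHS](frame_coordinates x) g_suml; apply: eq_bigr => i _.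
by rewrite gZl [g (e i) y]gC.
Qed.

Lemma functional_ext (f : V -> R) : (forall a x y, f (a *: x + y) = a * f x + f y) ->
  (forall i, f (e i) = 0) -> forall v, f v = 0.
Proof.
move=> fL f0 v; rewrite -(frame_coordinates v).
elim/big_rec: _ => [|i x _ IH]; last by rewrite fL f0 IH mulr0 addr0.
have := fL (-1) 0 0; rewrite scaler0 addr0 => ->; lra.
Qed.

Lemma linear_frame (f : V -> V) u : linear f -> f u = \sum_j g u (e j) *: f (e j).
Proof.
move=> fL; rewrite -[in LHS](frame_coordinates u).
elim/big_rec2: _ => [|i x y _ <-]; last by rewrite fL.
have := fL (-1) 0 0; rewrite scaler0 addr0 scaleN1r addNr; exact.
Qed.

Definition frame_end (A : 'Z_7 -> 'Z_7 -> R) : V -> V :=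
  fun u => \sum_i \sum_j (A i j * g (e j) u) *: e i.

Lemma frame_end_linear A : linear (frame_end A).
Proof.
move=> a u v; rewrite /frame_end scaler_sumr -big_split; apply: eq_bigr => i _ /=.
rewrite scaler_sumr -big_split; apply: eq_bigr => j _ /=.
rewrite gDr gZr scalerA -scalerDl; congr (_ *: _); ring.
Qed.

Lemma frame_end_basis A j : frame_end A (e j) = \sum_i A i j *: e i.
Proof.
apply: eq_bigr => i _; rewrite (bigD1 j) //= orth eqxx mulr1 big1 ?addr0 // => k kj.
by rewrite orth (negbTE kj) mulr0 scale0r.
Qed.

Lemma frame_end_entry A i j : g (frame_end A (e j)) (e i) = A i j.
Proof.
rewrite frame_end_basis g_suml (bigD1 i) //= gZl orth eqxx mulr1 big1 ?addr0 // => k ki.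
by rewrite gZl orth (negbTE ki) mulr0.
Qed.

Lemma linear_ext (f h : V -> V) : linear f -> linear h ->
  (forall i j, g (f (e j)) (e i) = g (h (e j)) (e i)) -> f = h.
Proof.
move=> fL hL fh; apply/funext => u; rewrite (linear_frame u fL) (linear_frame u hL).
by apply: eq_bigr => j _; congr (_ *: _); apply: frame_ext => i.
Qed.

Lemma g_frame_end A u v : g (frame_end A u) v =
  \sum_i \sum_j A i j * (g (e j) u * g (e i) v).
Proof.
rewrite g_suml; apply: eq_bigr => i _; rewrite g_suml; apply: eq_bigr => j _.
by rewrite gZl mulrA.
Qed.

Lemma frame_end_skew A : (forall i j, A j i = - A i j) -> skew_end g (frame_end A).
Proof.
move=> As; split; first exact: frame_end_linear.
move=> u v; rewrite [g u _]gC !g_frame_end exchange_big -sumrN; apply: eq_bigr => i _.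
rewrite -sumrN; apply: eq_bigr => j _; rewrite As; ring.
Qed.

Lemma frame_end_sym A : (forall i j, A j i = A i j) ->
  forall u v, g (frame_end A u) v = g u (frame_end A v).
Proof.
move=> As u v; rewrite [g u _]gC !g_frame_end exchange_big; apply: eq_bigr => i _.
apply: eq_bigr => j _; rewrite As; ring.
Qed.

End Basis.

Lemma frame_end_trace e e' A : orthonormal_basis g e -> orthonormal_basis g e' ->
  \sum_i g (frame_end e A (e' i)) (e' i) = \sum_i A i i.
Proof.
move=> oe oe'; under eq_bigr do rewrite g_frame_end.
rewrite exchange_big; apply: eq_bigr => i _; rewrite exchange_big /=.
under eq_bigr => j _ do rewrite -mulr_sumr (parseval oe').
rewrite (bigD1 i) //= oe.1 eqxx mulr1 big1 ?addr0 // => j ji.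
by rewrite oe.1 (negbTE ji) mulr0.
Qed.

(** Expanding both endomorphisms in [e] leaves sums over [e'] of products of
coordinates, which Parseval evaluates. *)
Lemma frobenius_basis e e' (a b : V -> V) : orthonormal_basis g e ->
  orthonormal_basis g e' -> linear a -> linear b ->
  \sum_i g (a (e' i)) (b (e' i)) = \sum_i g (a (e i)) (b (e i)).
Proof.
move=> oe oe' aL bL.
transitivity (\sum_i \sum_j \sum_k (g (e' i) (e j) * g (e' i) (e k)) * g (a (e j))
  (b (e k))).
  apply: eq_bigr => i _; rewrite (linear_frame oe _ aL) (linear_frame oe _ bL).
  rewrite g_suml; apply: eq_bigr => j _; rewrite g_sumr; apply: eq_bigr => k _.
  by rewrite gZl gZr mulrA.
rewrite exchange_big; apply: eq_bigr => j _; rewrite exchange_big /=.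
rewrite (eq_bigr (fun k => (j == k)%:R * g (a (e j)) (b (e k)))) => [|k _].
  rewrite (bigD1 j) //= eqxx mul1r big1 ?addr0 // => k kj.
  by rewrite eq_sym (negbTE kj) mul0r.
rewrite -mulr_suml; congr (_ * _); rewrite -oe.1 -(parseval oe').
by apply: eq_bigr => i _; rewrite !(gC (e' i)).
Qed.

(** The summands are independent: the symmetric part of a vanishing sum separates
the first and third, which the trace tells apart, and what is left of the second
belongs to it and to its orthogonal complement, so has norm zero. *)
Lemma G2_componentE e phi (a : V -> V) (c : nat -> V -> V) :
  orthonormal_basis g e ->
  (forall l, (1 <= l <= 4)%N -> G2_summand g phi l (c l)) ->
  a = \sum_(1 <= l < 5) c l ->
  forall k, (1 <= k <= 4)%N -> G2_component g phi k a = c k.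
Proof.
move=> oe cS aE k k4; rewrite /G2_component.
set P := [set b : nat -> V -> V | _].
have Pc : P c by [].
have [bS bE] := xgetI (fun=> 0) Pc.
move: (xget (fun=> 0) P) bS bE => b bS bE.
have sumE (d : nat -> V -> V) : \sum_(1 <= l < 5) d l = d 1%N + d 2%N + d 3%N + d 4%N.
  by rewrite /index_iota /= !big_cons big_nil addr0 !addrA.
have [x bx] : scalar_end (b 1%N) := bS 1%N isT.
have [y cy] : scalar_end (c 1%N) := cS 1%N isT.
have [[b2L b2s] b2d] : g2_end g phi (b 2%N) := bS 2%N isT.
have [[c2L c2s] c2d] : g2_end g phi (c 2%N) := cS 2%N isT.
have [b3L b3s b3t] : tracefree_sym_end g (b 3%N) := bS 3%N isT.
have [c3L c3s c3t] : tracefree_sym_end g (c 3%N) := cS 3%N isT.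
have [[b4L b4s] b4p] : g2_perp_end g phi (b 4%N) := bS 4%N isT.
have [[c4L c4s] c4p] : g2_perp_end g phi (c 4%N) := cS 4%N isT.
have E u : x *: u + b 2%N u + b 3%N u + b 4%N u = y *: u + c 2%N u + c 3%N u + c 4%N u.
  have := congr1 (fun f => f u) (etrans (esym bE) aE).
  by rewrite !sumE bx cy.
have sym u v : x * g u v + g (b 3%N u) v = y * g u v + g (c 3%N u) v.
  have h1 := congr1 (fun w => g w v) (E u); have h2 := congr1 (fun w => g u w) (E v).
  move: h1 h2 => /=; rewrite !gDl !gDr !gZl !gZr.
  by rewrite b2s b3s b4s c2s c3s c4s => h1 h2; lra.
have xy : x = y.
  have : \sum_i (x * g (e i) (e i) + g (b 3%N (e i)) (e i)) =
         \sum_i (y * g (e i) (e i) + g (c 3%N (e i)) (e i)).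
    by apply: eq_bigr => i _; exact: sym.
  rewrite !big_split /= b3t // c3t // !addr0 -!mulr_sumr.
  apply: mulIf; rewrite (eq_bigr (fun=> 1)) => [|i _]; last by rewrite oe.1 eqxx.
  by rewrite sumr_const card_ord pnatr_eq0.
have b3c3 : b 3%N = c 3%N.
  apply/funext => u; apply: (frame_ext oe) => i.
  by have := sym u (e i); rewrite xy => /addrI.
have E' u : b 2%N u - c 2%N u = c 4%N u - b 4%N u.
  have := E u; rewrite xy b3c3 -!addrA => /addrI.
  rewrite ![_ + (c 3%N u + _)]addrCA => /addrI h.
  by apply/eqP; rewrite subr_eq addrAC eq_sym subr_eq addrC eq_sym; apply/eqP;
    rewrite h addrC.
have d0 : b 2%N = c 2%N.
  (* Being also a difference of elements of the complement, [d] is orthogonal to itself. *)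
  pose d v := b 2%N v - c 2%N v.
  have dd : \sum_i g (d (e i)) (d (e i)) = 0.
    transitivity (\sum_i (g (c 4%N (e i)) (b 2%N (e i)) - g (c 4%N (e i)) (c 2%N (e i))
       - (g (b 4%N (e i)) (b 2%N (e i)) - g (b 4%N (e i)) (c 2%N (e i))))).
      by apply: eq_bigr => i _; rewrite {1}/d E' /d !(gDl, gDr, gNl, gNr); ring.
    rewrite !sumrB (c4p _ e (bS 2%N isT) oe) (c4p _ e (cS 2%N isT) oe).
    by rewrite (b4p _ e (bS 2%N isT) oe) (b4p _ e (cS 2%N isT) oe) !subr0.
  apply: (linear_ext oe b2L c2L) => i j; apply/eqP; rewrite -subr_eq0 -gNl -gDl.
  have sq n : 0 <= g (d (e n)) (d (e n)).
    by rewrite -(parseval oe); apply: sumr_ge0 => l _; rewrite -expr2 sqr_ge0.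
  have /eqP := psumr_eq0P (fun n _ => sq n) dd (i := j) isT.
  rewrite -(parseval oe) psumr_eq0 => [/allP/(_ i)|l _]; last by rewrite -expr2 sqr_ge0.
  by rewrite mem_index_enum mulf_eq0 orbb; apply.
have b4c4 : b 4%N = c 4%N.
  apply/funext => u; have := E' u; rewrite d0 subrr => /eqP.
  by rewrite eq_sym subr_eq0 => /eqP.
have b1c1 : b 1%N = c 1%N by rewrite bx cy xy.
by case: k k4 => [|[|[|[|[|k]]]]].
Qed.

End Endomorphisms.

(** * The cross product *)

Section SumFront.
Variables (R : nmodType) (I : finType).

Lemma sum_front3 (F : I -> I -> I -> R) :
  \sum_i \sum_j \sum_k F i j k = \sum_k \sum_i \sum_j F i j k.
Proof. by under eq_bigr do rewrite exchange_big; rewrite exchange_big. Qed.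

Lemma sum_front4 (F : I -> I -> I -> I -> R) :
  \sum_i \sum_j \sum_k \sum_l F i j k l = \sum_l \sum_i \sum_j \sum_k F i j k l.
Proof. by under eq_bigr do rewrite sum_front3; rewrite exchange_big. Qed.

End SumFront.

Section CrossProduct.
Context {R : realType} {V : lmodType R} (g : V -> V -> R).
Hypothesis gC : forall x y, g x y = g y x.
Hypothesis gL : forall a x y z, g (a *: x + y) z = a * g x z + g y z.
Variable e : 'Z_7 -> V.
Hypothesis ortho : orthonormal_basis g e.
Variable phi : multiform V 3.
Hypothesis phiA : alternating_form phi.
Hypothesis phiE : forall v, phi v = cayley_form g e v.
Let orth := ortho.1.

Definition phi_at u v w := phi (tnth [tuple u; v; w]).

Lemma tnth3E (T : Type) (u v w : T) (i : 'I_3) : tnth [tuple u; v; w] i =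
  if val i == 0%N then u else if val i == 1%N then v else w.
Proof. by rewrite (tnth_nth u); case: i => -[|[|[|]]]. Qed.

Lemma tnth3_update3 (T : Type) (u v w x : T) :
  tnth [tuple u; v; x] = [eta tnth [tuple u; v; w] with ord_max |-> x].
Proof.
apply/funext => i /=; rewrite !tnth3E -val_eqE /=.
by case: i => -[|[|[|]]].
Qed.

Lemma phi_atL3 u v a x y :
  phi_at u v (a *: x + y) = a * phi_at u v x + phi_at u v y.
Proof.
by rewrite /phi_at (tnth3_update3 u v 0 (_ + _)) phiA.1 -!tnth3_update3.
Qed.

Lemma phi_at_swap12 u v w : phi_at v u w = - phi_at u v w.
Proof.
rewrite /phi_at -(@alternating_swap _ _ _ _ phiA _ ord0 (lift ord0 ord0)) //.
congr phi; apply/funext => i /=; rewrite !tnth3E permE /= -!val_eqE /=.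
by case: i => -[|[|[|]]].
Qed.

Lemma phi_at_swap23 u v w : phi_at u w v = - phi_at u v w.
Proof.
rewrite /phi_at -(@alternating_swap _ _ _ _ phiA _ (lift ord0 ord0) ord_max) //.
congr phi; apply/funext => i /=; rewrite !tnth3E permE /= -!val_eqE /=.
by case: i => -[|[|[|]]].
Qed.

Lemma phi_atL2 u v a x y :
  phi_at u (a *: x + y) v = a * phi_at u x v + phi_at u y v.
Proof. by rewrite phi_at_swap23 phi_atL3 opprD -mulrN -!phi_at_swap23. Qed.

Lemma phi_atL1 u v a x y :
  phi_at (a *: x + y) u v = a * phi_at x u v + phi_at y u v.
Proof. by rewrite phi_at_swap12 phi_atL2 opprD -mulrN -!phi_at_swap12. Qed.

Lemma phi_at_cycle u v w : phi_at v w u = phi_at u v w.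
Proof. by rewrite phi_at_swap23 phi_at_swap12 opprK. Qed.

Lemma phi_at_basis (i j k : 'Z_7) : phi_at (e i) (e j) (e k) = (phi_entry i j k)%:~R.
Proof.
pose K := tnth [tuple i; j; k].
have -> : phi_at (e i) (e j) (e k) = phi (e \o K).
  congr phi; apply/funext => l; rewrite tnth3E /K /comp tnth3E.
  by case: ifP => // _; case: ifP.
rewrite (phi_components orth phiE).
have -> // : vals K = [:: val i; val j; val k].
by apply: vals_eq => // l; rewrite /K tnth3E; case: l => -[|[|[|]]].
Qed.

Lemma cross_phi u v z : g (cross g phi u v) z = phi_at u v z.
Proof.
have /= := @xgetPex _ 0 [set w | forall z, g w z = phi (tnth [tuple u; v; z])].
apply; exists (\sum_k phi_at u v (e k) *: e k) => {}z.
rewrite (g_suml gL); apply/eqP; rewrite -subr_eq0; apply/eqP.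
apply: (functional_ext gL ortho (f := fun z => \sum_i g (phi_at u v (e i) *:
  e i) z - phi_at u v z)).
  move=> a x y; rewrite phi_atL3 mulrBr addrACA -opprD mulr_sumr -big_split.
  by congr (_ - _); apply: eq_bigr => i _; rewrite (gDr gC gL) (gZr gC gL).
move=> i; rewrite (bigD1 i) //= (gZl gL) orth eqxx mulr1 big1 ?addr0 ?subrr // => j ji.
by rewrite (gZl gL) orth (negbTE ji) mulr0.
Qed.

Lemma cross_linear_r u : linear (cross g phi u).
Proof.
move=> a x y; apply: (frame_ext gL ortho) => i.
by rewrite gL !cross_phi phi_atL2.
Qed.

Lemma cross_linear_l v : linear (fun u => cross g phi u v).
Proof.
move=> a x y; apply: (frame_ext gL ortho) => i.
by rewrite gL !cross_phi phi_atL1.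
Qed.

Lemma cross_basis (i j : 'Z_7) :
  cross g phi (e i) (e j) = \sum_(k : 'Z_7) (phi_entry i j k)%:~R *: e k.
Proof.
rewrite -[LHS](frame_coordinates gL ortho); apply: eq_bigr => k _.
by rewrite cross_phi phi_at_basis.
Qed.

Lemma A_skew v : skew_end g (A_ g phi v).
Proof.
split=> [|u w]; first exact: cross_linear_l.
by rewrite /A_ [g u _]gC !cross_phi [phi_at w v u]phi_at_swap12 [phi_at v w
  u]phi_at_cycle opprK.
Qed.

(** For a skew endomorphism, to be a derivation of the cross product is to
annihilate phi, a trilinear condition that is checked on the frame. *)
Lemma frame_end_g2 (A : 'Z_7 -> 'Z_7 -> R) : (forall i j, A j i = - A i j) ->
  (forall i j l : 'Z_7, \sum_(k : 'Z_7) ((phi_entry i j k)%:~R * A k l +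
     (phi_entry k j l)%:~R * A k i + (phi_entry i k l)%:~R * A k j) = 0) ->
  g2_end g phi (frame_end g e A).
Proof.
move=> As A0; set b := frame_end g e A.
have bL : linear b by exact: (frame_end_linear gC gL).
have [_ bs] : skew_end g b := frame_end_skew gC gL e As.
split; first exact: (frame_end_skew gC gL e As).
pose F u v z := phi_at u v (b z) + phi_at (b u) v z + phi_at u (b v) z.
suff F0 u v z : F u v z = 0.
  move=> u v; apply: (frame_ext gL ortho) => i.
  rewrite bs (gDl gL) !cross_phi; have := F0 u v (e i); rewrite /F => h; lra.
move: u v z; have L3 u v a x y : F u v (a *: x + y) = a * F u v x + F u v y.
  by rewrite /F bL !phi_atL3; ring.
have L2 u z a x y : F u (a *: x + y) z = a * F u x z + F u y z.
  by rewrite /F bL !phi_atL2; ring.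
have L1 v z a x y : F (a *: x + y) v z = a * F x v z + F y v z.
  by rewrite /F bL !phi_atL1; ring.
move=> u v z; move: u; apply: (functional_ext gL ortho (L1 v z)) => i.
move: v; apply: (functional_ext gL ortho (L2 (e i) z)) => j.
move: z; apply: (functional_ext gL ortho (L3 (e i) (e j))) => l.
rewrite -[RHS](A0 i j l) /F !big_split /= /b !(frame_end_basis ortho).
have S (f : V -> R) (c : 'Z_7 -> R) : (forall a x y, f (a *: x + y) = a * f x + f y) ->
    f (\sum_k c k *: e k) = \sum_k f (e k) * c k.
  move=> fL; elim/big_rec2: _ => [|k x y _ <-]; last by rewrite fL mulrC.
  have := fL (-1) 0 0; rewrite scaler0 addr0 => ->; lra.
rewrite (S (phi_at (e i) (e j))) => [|*]; last exact: phi_atL3.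
rewrite (S (fun x => phi_at x (e j) (e l))) => [|*]; last exact: phi_atL1.
rewrite (S (fun x => phi_at (e i) x (e l))) => [|*]; last exact: phi_atL2.
by congr (_ + _ + _); apply: eq_bigr => k _; rewrite phi_at_basis.
Qed.

Lemma phi_sum3 (c : 'Z_7 -> R) u v :
  phi_at u v (\sum_k c k *: e k) = \sum_k c k * phi_at u v (e k).
Proof.
elim/big_rec2: _ => [|k x y _ <-]; last by rewrite phi_atL3.
have := phi_atL3 u v (-1) 0 0; rewrite scaler0 addr0 => ->; lra.
Qed.

(** For a derivation [b] of the cross product, the contraction of the vanishing
tensor [b . phi] with the four-form is a multiple of the contraction of [b] with
phi; hence the latter, which is the inner product of [b] with [A_v], vanishes. *)
Lemma A_g2_perp v : g2_perp_end g phi (A_ g phi v).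
Proof.
split; first exact: A_skew.
move=> b e' bg oe'; have [[bL bs] bd] := bg.
rewrite (frobenius_basis gC gL ortho oe' (A_skew v).1 bL).
pose be k l := g (b (e l)) (e k).
have beE l : b (e l) = \sum_k be k l *: e k by rewrite (frame_coordinates gL ortho).
(* The derivation rule for [e i] and [e j], paired with [e l]. *)
have Rel (i j l : 'Z_7) : \sum_(k : 'Z_7) (be k l * (phi_entry i j k)%:~R +
     be k i * (phi_entry k j l)%:~R + be k j * (phi_entry i k l)%:~R) = 0.
  have := congr1 (fun x => g x (e l)) (bd (e i) (e j)).
  rewrite bs (gDl gL) !cross_phi => h.
  rewrite !big_split /=; move: h.
  have E1 : phi_at (e i) (e j) (b (e l)) = \sum_k be k l * (phi_entry i j k)%:~R.
    by rewrite beE phi_sum3; apply: eq_bigr => k _; rewrite phi_at_basis.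
  have E2 : phi_at (b (e i)) (e j) (e l) = \sum_k be k i * (phi_entry k j l)%:~R.
    rewrite -phi_at_cycle beE phi_sum3; apply: eq_bigr => k _.
    by rewrite phi_at_cycle phi_at_basis.
  have E3 : phi_at (e i) (b (e j)) (e l) = \sum_k be k j * (phi_entry i k l)%:~R.
    rewrite -[LHS]phi_at_cycle -[LHS]phi_at_cycle beE phi_sum3; apply: eq_bigr => k _.
    by rewrite -phi_at_cycle phi_at_basis.
  by rewrite E1 E2 E3 => h; lra.
(* The relations contracted with the four-form. *)
have Z (n : 'Z_7) : \sum_(k : 'Z_7) \sum_(l : 'Z_7) be k l * (phi_entry n k l)%:~R = 0.
  have : \sum_(i : 'Z_7) \sum_(j : 'Z_7) \sum_(l : 'Z_7) (psi_entry n i j l)%:~R *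
     \sum_(k : 'Z_7) (be k l * (phi_entry i j k)%:~R +
     be k i * (phi_entry k j l)%:~R + be k j * (phi_entry i k l)%:~R) = 0 :> R.
    by rewrite big1 // => i _; rewrite big1 // => j _; rewrite big1 // => l _;
      rewrite Rel mulr0.
  under eq_bigr => i _ do under eq_bigr => j _ do under eq_bigr => l _ do
    rewrite !big_split !mulrDr /=.
  under eq_bigr => i _ do under eq_bigr => j _ do rewrite !big_split /=.
  under eq_bigr => i _ do rewrite !big_split /=.
  rewrite !big_split /=.
  set X := (X in X + _ + _ = 0); set Y := (Y in _ + Y + _ = 0);
    set W := (W in _ + _ + W = 0).
  have -> : X = \sum_(k : 'Z_7) \sum_(l : 'Z_7) be k l *
      \sum_(i : 'Z_7) \sum_(j : 'Z_7) (psi_entry n i j l * phi_entry i j k)%:~R.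
    rewrite /X; under eq_bigr => i _ do under eq_bigr => j _ do under eq_bigr =>
      l _ do rewrite mulr_sumr.
    rewrite sum_front4; apply: eq_bigr => k _; rewrite sum_front3; apply: eq_bigr => l _.
    rewrite mulr_sumr; apply: eq_bigr => i _; rewrite mulr_sumr; apply: eq_bigr => j _.
    by rewrite intrM mulrCA.
  have -> : Y = \sum_(k : 'Z_7) \sum_(l : 'Z_7) be k l *
      \sum_(i : 'Z_7) \sum_(j : 'Z_7) (psi_entry n l i j * phi_entry k i j)%:~R.
    rewrite /Y; under eq_bigr => i _ do under eq_bigr => j _ do under eq_bigr =>
      l _ do rewrite mulr_sumr.
    rewrite sum_front4; apply: eq_bigr => k _; apply: eq_bigr => l _.
    rewrite mulr_sumr; apply: eq_bigr => i _; rewrite mulr_sumr; apply: eq_bigr => j _.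
    by rewrite intrM mulrCA.
  have -> : W = \sum_(k : 'Z_7) \sum_(l : 'Z_7) be k l *
      \sum_(i : 'Z_7) \sum_(j : 'Z_7) (psi_entry n i l j * phi_entry i k j)%:~R.
    rewrite /W; under eq_bigr => i _ do under eq_bigr => j _ do under eq_bigr =>
      l _ do rewrite mulr_sumr.
    rewrite sum_front4; apply: eq_bigr => k _; rewrite exchange_big;
      apply: eq_bigr => l _ /=.
    rewrite mulr_sumr; apply: eq_bigr => i _; rewrite mulr_sumr; apply: eq_bigr => j _.
    by rewrite intrM mulrCA.
  rewrite -!big_split /= => h; apply: (@mulfI _ 12%:R); first by rewrite pnatr_eq0.
  rewrite mulr0 -[RHS]h mulr_sumr; apply: eq_bigr => k _; rewrite -!big_split mulr_sumr.
  apply: eq_bigr => l _ /=; rewrite -!mulrDr mulrCA; congr (_ * _).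
  rewrite -[12%:R]/(12%:~R) -intrM -(eqP (forall7P (forall7P (forall7P
    psi_phi_contraction n) k) l)).
  rewrite sum_belowE rmorph_sum -!big_split; apply: eq_bigr => i _.
  rewrite sum_belowE rmorph_sum -!big_split; apply: eq_bigr => j _ /=.
  by rewrite !intrD.
pose S w := \sum_i phi_at (e i) w (b (e i)).
suff S0 : S v = 0.
  by rewrite -[RHS]S0; apply: eq_bigr => i _; rewrite cross_phi.
apply: (functional_ext gL ortho) => [a x y|n].
  by rewrite /S mulr_sumr -big_split; apply: eq_bigr => i _; rewrite phi_atL2.
rewrite /S -[RHS](Z n) exchange_big; apply: eq_bigr => i _ /=.
rewrite beE phi_sum3; apply: eq_bigr => k _.
by rewrite -phi_at_cycle phi_at_basis.
Qed.

End CrossProduct.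

(** * The dual four-form *)

Section HodgeAlternating.
Context {R : realType} {V : lmodType R}.

Lemma codom_fcat k l (w : 'I_k -> V) (v : 'I_l -> V) (i : 'I_(k + l)) :
  (codom w ++ codom v)`_i = fcat w v i.
Proof.
have N m (u : 'I_m -> V) (j : 'I_m) : (codom u)`_j = u j.
  by rewrite /codom /image_mem (nth_map j) ?size_enum_ord // nth_ord_enum.
rewrite nth_cat size_codom card_ord -(splitK i).
case: (fintype.split i) => j /=; first by rewrite ltn_ord N fcat_l.
by rewrite ltnNge leq_addr /= addKn N fcat_r.
Qed.

Lemma alternating_tail k l n (al : multiform V n) (w : 'I_k -> V) : (k + l = n)%N ->
  alternating_form al ->
  alternating_form (fun v : 'I_l -> V => al (fun i => (codom w ++ codom v)`_i)).
Proof.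
move=> kl; subst n => alA.
have E (v : 'I_l -> V) : (fun i : 'I_(k + l) => (codom w ++ codom v)`_i) = fcat w v.
  by apply/funext => i; exact: codom_fcat.
have U (v : 'I_l -> V) i x : fcat w [eta v with i |-> x] =
    [eta fcat w v with rshift k i |-> x].
  apply/funext => j /=; rewrite -(splitK j); case: (fintype.split j) => b /=.
    by rewrite !fcat_l -val_eqE /= ltn_eqF // (leq_trans (ltn_ord b)) ?leq_addr.
  by rewrite !fcat_r -!val_eqE /= eqn_add2l.
split=> [v i a x y|v i j ij vij].
  by rewrite !E !U alA.1.
rewrite E; apply: (alA.2 _ (rshift k i) (rshift k j)); last by rewrite !fcat_r.
by rewrite -val_eqE /= eqn_add2l val_eqE.
Qed.

Variables (g : V -> V -> R) (e : 'Z_7 -> V).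
Hypothesis gC : forall x y, g x y = g y x.
Hypothesis gL : forall a x y z, g (a *: x + y) z = a * g x z + g y z.

Lemma hodge_alternating k (al : multiform V k) : (k <= 7)%N ->
  alternating_form (hodge g e al).
Proof.
move=> k7.
have volA : alternating_form (volume_form g e).
  apply: (@det_alternating _ _ 7 (fun a x => g (e a) x)) => i a x y.
  by rewrite (gDr gC gL) (gZr gC gL).
have A I := alternating_tail (e \o I : 'I_k -> V) (subnKC k7) volA.
split=> [v i a x y|v i j ij vij]; rewrite /hodge.
  rewrite mulrCA -mulrDr; congr (_ * _); rewrite mulr_sumr -big_split.
  by apply: eq_bigr => I _; rewrite (A I).1 /= mulrDr mulrCA.
by rewrite big1 ?mulr0 // => I _; rewrite ((A I).2 _ _ _ ij vij) mulr0.
Qed.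

Variable phi : multiform V 3.
Hypothesis ortho : orthonormal_basis g e.
Hypothesis phiA : alternating_form phi.
Hypothesis phiE : forall v, phi v = cayley_form g e v.

(** Both sides are multilinear, and on the frame this is [phi_phi_contraction]. *)
Lemma hodge_cayley (v : 'I_4 -> V) :
  hodge g e phi v =
  g (v 0) (v 2) * g (v 1) (v 3) - g (v 1) (v 2) * g (v 0) (v 3) -
  \sum_k phi_at phi (v 0) (v 1) (e k) * phi_at phi (v 2) (v 3) (e k).
Proof.
have psiA := hodge_alternating phi (isT : 3 <= 7)%N.
pose Q a b c d := g a c * g b d - g b c * g a d -
  \sum_k phi_at phi a b (e k) * phi_at phi c d (e k).
have S (p q r : 'Z_7 -> R) (a : R) :
    \sum_k (a * p k + q k) * r k = a * \sum_k p k * r k + \sum_k q k * r k.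
  rewrite mulr_sumr -big_split; apply: eq_bigr => k _ /=; ring.
have S' (p q r : 'Z_7 -> R) (a : R) :
    \sum_k r k * (a * p k + q k) = a * \sum_k r k * p k + \sum_k r k * q k.
  rewrite mulr_sumr -big_split; apply: eq_bigr => k _ /=; ring.
have gR a x y z : g z (a *: x + y) = a * g z x + g z y by rewrite gC gL !(gC z).
have Q0 b c d a x y : Q (a *: x + y) b c d = a * Q x b c d + Q y b c d.
  by rewrite /Q !gL; under eq_bigr do rewrite (phi_atL1 phiA); rewrite S; ring.
have Q1 b c d a x y : Q b (a *: x + y) c d = a * Q b x c d + Q b y c d.
  by rewrite /Q !gL; under eq_bigr do rewrite (phi_atL2 phiA); rewrite S; ring.
have Q2 b c d a x y : Q b c (a *: x + y) d = a * Q b c x d + Q b c y d.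
  by rewrite /Q !gR; under eq_bigr do rewrite (phi_atL1 phiA); rewrite S'; ring.
have Q3 b c d a x y : Q b c d (a *: x + y) = a * Q b c d x + Q b c d y.
  by rewrite /Q !gR; under eq_bigr do rewrite (phi_atL2 phiA); rewrite S'; ring.
apply/eqP; rewrite -subr_eq0; apply/eqP; move: v.
apply: (@multilinear_ext _ _ _ e 4 (fun v => hodge g e phi v - Q (v 0) (v 1) (v 2)
  (v 3)) ortho.2).
  move=> v i a x y; rewrite psiA.1; case: i => -[|[|[|[|//]]]] i4 /=.
  - rewrite Q0; ring.
  - rewrite Q1; ring.
  - rewrite Q2; ring.
  - rewrite Q3; ring.
move=> J; apply/eqP; rewrite subr_eq0; apply/eqP.
rewrite (psi_components ortho.1 phiE) /Q /= !ortho.1.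
have -> : psi_coef (vals J) = psi_entry (J 0) (J 1) (J 2) (J 3) by congr psi_entry;
  [exact: (nth_vals J 0)|exact: (nth_vals J 1)|exact: (nth_vals J 2)|exact: (nth_vals J 3)].
have := eqP (forall7P (forall7P (forall7P (forall7P phi_phi_contraction (J 0)) (J 1))
  (J 2)) (J 3)).
rewrite sum_belowE => /(congr1 (fun z : int => z%:~R : R)).
have B (b c : bool) : ((b && c)%:Z)%:~R = b%:R * c%:R :> R.
  by case: b c => [] []; rewrite ?mulr1 ?mulr0.
rewrite !intrB rmorph_sum /= !B !val_eqE.
set X := \sum_i _; set Y := \sum_k _; have -> : X = Y.
  apply: eq_bigr => k _; rewrite !(phi_at_basis ortho phiE) intrM; congr (_ * _%:~R).
  by have /andP[_ /eqP] := forall7P (forall7P (forall7P phi_entry_sym k) (J 2)) (J 3).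
by move=> ->; ring.
Qed.

End HodgeAlternating.

(** * The torsion endomorphism at a point *)

Section TorsionComponents.
Context {R : realType} {V : lmodType R} (g : V -> V -> R) (e : 'Z_7 -> V).
Hypothesis gC : forall x y, g x y = g y x.
Hypothesis gL : forall a x y z, g (a *: x + y) z = a * g x z + g y z.
Hypothesis ortho : orthonormal_basis g e.
Variable phi : multiform V 3.
Hypothesis phiA : alternating_form phi.
Hypothesis phiE : forall v, phi v = cayley_form g e v.
Variable T : V -> V.
Hypothesis TL : linear T.

Let psi : multiform V 4 := hodge g e phi.
Let times := cross g phi.
Let t (m a : 'Z_7) := g (T (e a)) (e m).
Let tr := \sum_i t i i.

Variables (dphi : multiform V 4) (dpsi : multiform V 5).
Hypothesis dphi_torsion : forall J : 'I_4 -> 'Z_7,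
  dphi (e \o J) = \sum_(i < 4) (-1) ^+ i * \sum_(b < 3)
    phi [eta e \o (J \o lift i) with b |-> times (e (J (lift i b))) (T (e (J i)))].
Hypothesis dpsi_torsion : forall J : 'I_5 -> 'Z_7,
  dpsi (e \o J) = \sum_(i < 5) (-1) ^+ i * \sum_(b < 4)
    psi [eta e \o (J \o lift i) with b |-> times (e (J (lift i b))) (T (e (J i)))].

Lemma torsion_basis (a b : 'Z_7) : times (e b) (T (e a)) =
  \sum_(m : 'Z_7) \sum_(r : 'Z_7) (t m a * (phi_entry b m r)%:~R) *: e r.
Proof.
have cL := cross_linear_r gC gL ortho phiA.
rewrite -[T (e a)](frame_coordinates gL ortho) /times.
rewrite (_ : cross g phi (e b) (\sum_m g (T (e a)) (e m) *: e m) =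
  \sum_m t m a *: cross g phi (e b) (e m)).
  apply: eq_bigr => m _; rewrite (cross_basis gC gL ortho phiA phiE) scaler_sumr.
  by apply: eq_bigr => r _; rewrite scalerA.
elim/big_rec2: _ => [|m x y _ <-]; last by rewrite cL.
have := cL (e b) (-1) 0 0; rewrite scaler0 addr0 scaleN1r addNr; exact.
Qed.

(** By linearity the two derivatives are the alternations of a derivation that
[d_components] evaluates. *)
Lemma dphi_components J : dphi (e \o J) = int_comb t (d_coef phi_coef (vals J)).
Proof.
rewrite dphi_torsion.
exact: (d_components (B := fun x y =>
  times y (T x)) phiA (phi_components ortho.1 phiE) torsion_basis).
Qed.

Lemma dphi_antisymmetric :
  antisymmetric_fun (fun J : 'I_4 -> 'Z_7 => int_comb t (d_coef phi_coef (vals J))).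
Proof.
exact: (d_components_antisymmetric (B := fun x y =>
  times y (T x)) phiA (phi_components ortho.1 phiE) torsion_basis).
Qed.

Let psiA : alternating_form psi := hodge_alternating e gC gL phi isT.

Lemma dpsi_components J : dpsi (e \o J) = int_comb t (d_coef psi_coef (vals J)).
Proof.
rewrite dpsi_torsion.
exact: (d_components (B := fun x y =>
  times y (T x)) psiA (psi_components ortho.1 phiE) torsion_basis).
Qed.

Lemma dpsi_antisymmetric :
  antisymmetric_fun (fun J : 'I_5 -> 'Z_7 => int_comb t (d_coef psi_coef (vals J))).
Proof.
exact: (d_components_antisymmetric (B := fun x y =>
  times y (T x)) psiA (psi_components ortho.1 phiE) torsion_basis).
Qed.

Let ten i j := rank_one g (e i) (e j).
Let dual i := coframe g e (tnth [tuple i]).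
Let pd : multiform V 1 := hodge g e (wedge (hodge g e dphi) phi).

Lemma rank_one_sum (A : 'Z_7 -> 'Z_7 -> R) :
  \sum_i \sum_j A i j *: ten i j = frame_end g e A.
Proof.
apply/funext => u; rewrite fct_sumE; apply: eq_bigr => i _.
rewrite fct_sumE; apply: eq_bigr => j _.
by rewrite /= -[LHS]/(A i j *: (g (e j) u *: e i)) scalerA.
Qed.

Lemma eq_frame_end (A A' : 'Z_7 -> 'Z_7 -> R) : (forall i j, A i j = A' i j) ->
  frame_end g e A = frame_end g e A'.
Proof. by move=> h; rewrite -!rank_one_sum; apply: eq_bigr => i _;
  apply: eq_bigr => j _; rewrite h. Qed.

(** The excluded diagonal terms vanish, so the sum may run over all pairs. *)
Lemma skew_rank_one_sum (c : 'Z_7 -> 'Z_7 -> R) :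
  \sum_i \sum_(j | i != j) c i j *: (ten i j - ten j i) =
  frame_end g e (fun i j => c i j - c j i).
Proof.
transitivity (\sum_i \sum_j c i j *: (ten i j - ten j i)).
  apply: eq_bigr => i _; rewrite [RHS](bigD1 i) //= subrr scaler0 add0r.
  by apply: eq_bigl => j; rewrite eq_sym.
rewrite -rank_one_sum.
under [RHS]eq_bigr => i _ do under eq_bigr => j _ do rewrite scalerBl.
under [RHS]eq_bigr => i _ do rewrite sumrB.
rewrite sumrB [X in _ - X]exchange_big -sumrB; apply: eq_bigr => i _.
by rewrite -sumrB; apply: eq_bigr => j _; rewrite scalerBr.
Qed.

(** Each unordered pair produces the two symmetric entries. *)
Lemma sym_rank_one_sum (d : 'Z_7 -> R) (s : 'Z_7 -> 'Z_7 -> R) :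
  (forall i j, s i j = s j i) ->
  6^-1 *: (\sum_i d i *: ten i i) +
  12^-1 *: (\sum_(i : 'Z_7) \sum_(j : 'Z_7 | (i < j)%N) s i j *: (ten i j + ten j i)) =
  frame_end g e (fun i j => if i == j then d i / 6 else s i j / 12).
Proof.
move=> ss; rewrite -rank_one_sum.
have -> : \sum_(i : 'Z_7) \sum_(j : 'Z_7 | (i < j)%N) s i j *: (ten i j + ten j i) =
    \sum_i \sum_(j | j != i) s i j *: ten i j.
  under eq_bigr => i _ do under eq_bigr => j _ do rewrite scalerDr.
  under eq_bigr => i _ do rewrite big_split.
  rewrite big_split /= [X in _ + X](exchange_big_dep predT) //= -big_split.
  apply: eq_bigr => i _ /=; rewrite [RHS](bigID (fun j : 'Z_7 => (i < j)%N)) /=.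
  congr (_ + _); apply: eq_big => j //; last by rewrite ss.
  - by case: (ltngtP i j) => //; rewrite ?andbT ?andbF // -val_eqE /= => h; rewrite gtn_eqF.
  - by rewrite -leqNgt -val_eqE /= ltn_neqAle.
rewrite !scaler_sumr -big_split; apply: eq_bigr => i _ /=.
rewrite [RHS](bigD1 i) //= eqxx scalerA mulrC; congr (_ + _).
rewrite scaler_sumr; apply: eq_bigr => j ji.
by rewrite eq_sym (negbTE ji) scalerA mulrC.
Qed.

Lemma scale_frame_end (a : R) (A : 'Z_7 -> 'Z_7 -> R) :
  a *: frame_end g e A = frame_end g e (fun i j => a * A i j).
Proof.
rewrite -!rank_one_sum scaler_sumr; apply: eq_bigr => i _.
by rewrite scaler_sumr; apply: eq_bigr => j _; rewrite scalerA.
Qed.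

Let P (i j : 'Z_7) := int_comb t (psi_entry i j).

(** Contracting twice with phi projects onto the orthogonal complement of g2, up to
a factor. *)
Lemma phi_contraction (i j : 'Z_7) :
  \sum_(l : 'Z_7) (phi_entry i j l)%:~R * int_comb t (phi_entry l) = t i j - t j i - P i j.
Proof.
transitivity (int_comb t (fun m a => \sum_(l : 'Z_7) phi_entry i j l * phi_entry l m a)).
  by rewrite int_comb_sum; apply: eq_bigr => l _; rewrite int_combZ.
rewrite -(int_comb_entry t i j) -(int_comb_entry t j i) -!int_combN -!int_combD;
  apply: eq_int_comb => m a.
rewrite -(eqP (forall7P (forall7P (forall7P (forall7P phi_phi_contraction i) j) m) a)).
by rewrite sum_belowE.
Qed.

Lemma P_skew i j : P j i = - P i j.
Proof.
rewrite /P -int_combN; apply: eq_int_comb => m a.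
by have /andP[/eqP] := forall7P (forall7P (forall7P (forall7P psi_entry_sym i) j) m) a.
Qed.

Lemma int_comb_g2_part (i j : 'Z_7) : int_comb t (g2_part_coef i j) =
  2 * (t i j - t j i) + P i j.
Proof.
by rewrite -(int_comb_entry t i j) -(int_comb_entry t j i) -!int_combN -!int_combD
  -[2]/(2%:~R) -int_combZ -int_combD.
Qed.

Let star2 (i j : 'Z_7) := hodge g e (wedge (dual i) (dual j)).

(** The term with [pd] removes the part of the derivative of psi that comes from
the complement of g2. *)
Lemma torsion2_coefficient (i j : 'Z_7) :
  form_inner e (dpsi + 3^-1 *: (wedge pd psi : multiform V 5)) (star2 i j) =
  2 * (t i j - t j i) + P i j.
Proof.
rewrite form_innerC form_innerD (form_innerZ _ _ _ (wedge pd psi : multiform V 5)).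
rewrite !(form_innerC _ (star2 i j)).
rewrite (dpsi_star ortho.1 dpsi_components dpsi_antisymmetric).
rewrite (pd_psi_star ortho.1 phiE dphi_components dphi_antisymmetric).
have -> : int_comb t (fun m a => psi_entry i j a m) = - P i j.
  rewrite /P -int_combN; apply: eq_int_comb => m a.
  by have /andP[_ /eqP] := forall7P (forall7P (forall7P (forall7P psi_entry_sym i) j) m) a.
have -> : \sum_(l : 'Z_7) 6 * int_comb t (phi_entry l) * (phi_entry i j l)%:~R =
  6 * (t i j - t j i - P i j).
  rewrite -phi_contraction mulr_sumr; apply: eq_bigr => l _; ring.
by field.
Qed.

Lemma torsion2E :
  12^-1 *: (\sum_i \sum_(j | i != j)
    form_inner e (dpsi + 3^-1 *: (wedge pd psi : multiform V 5)) (star2 i j) *: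
      (ten i j - ten j i)) =
  frame_end g e (fun i j => 6^-1 * int_comb t (g2_part_coef i j)).
Proof.
rewrite skew_rank_one_sum scale_frame_end; apply: eq_frame_end => i j.
by rewrite !torsion2_coefficient int_comb_g2_part P_skew; field.
Qed.

Let contracted (i j : 'Z_7) : multiform V 4 := wedge (dual i) (interior_product (e j) psi).

Lemma contracted_sym (i j : 'Z_7) :
  form_inner e dphi (contracted i j + contracted j i) =
  6 * (t i j + t j i) + 12 * (i == j)%:R * tr.
Proof.
rewrite form_innerD !(dphi_wedge ortho.1 phiE dphi_components dphi_antisymmetric).
rewrite -(int_comb_entry t i j) -(int_comb_entry t j i) /tr -int_comb_trace -!int_combD.
have -> : 12 * (i == j)%:R = (12 * (i == j)%:Z)%:~R :> R by rewrite intrM.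
rewrite -[6]/(6%:~R) -!int_combZ -int_combD; apply: eq_int_comb => m a.
by rewrite (eqP (forall7P (forall7P (forall7P (forall7P dphi_wedge_coefE i) j) m) a)).
Qed.

Lemma form_inner_dphi_psi : form_inner e dphi psi = 12 * tr.
Proof. exact: (dphi_psi ortho.1 phiE dphi_components dphi_antisymmetric). Qed.

Lemma torsion3E :
  6^-1 *: (\sum_i form_inner e dphi (contracted i i - (4 / 7) *: psi) *: ten i i) +
  12^-1 *: (\sum_(i : 'Z_7) \sum_(j : 'Z_7 | (i < j)%N)
    form_inner e dphi (contracted i j + contracted j i) *: (ten i j + ten j i)) =
  frame_end g e (fun i j => (t i j + t j i) / 2 - (i == j)%:R * tr / 7).
Proof.
rewrite sym_rank_one_sum => [|i j]; last by rewrite addrC.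
apply: eq_frame_end => i j; rewrite contracted_sym.
have [<-|_] := eqVneq i j; last by rewrite /= mulr0 !mul0r; field.
have := contracted_sym i i; rewrite eqxx form_innerD mulr1 => h.
rewrite form_innerD -scaleNr (form_innerZ _ _ _ psi) form_inner_dphi_psi. 
have -> : form_inner e dphi (contracted i i) = 6 * t i i + 6 * tr by lra.
by rewrite /= mul1r; field.
Qed.

Let v := sharp g pd.

Lemma sharp_spec (al : multiform V 1) : alternating_form al ->
  forall z, g (sharp g al) z = al (fun=> z).
Proof.
move=> alA; have alL a x y : al (fun=> a *: x + y) = a * al (fun=> x) + al (fun=> y).
  have E z : (fun=> z) = [eta (fun=> 0) with ord0 |-> z] :> ('I_1 -> V).
    by apply/funext => i /=; rewrite (ord1 i).
  by rewrite (E (_ + _)) (E x) (E y) alA.1.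
have /= := @xgetPex _ 0 [set w | forall z, g w z = al (fun=> z)].
apply; exists (\sum_k al (fun=> e k) *: e k) => z.
rewrite (g_suml gL); apply/eqP; rewrite -subr_eq0; apply/eqP.
apply: (functional_ext gL ortho (f := fun z => \sum_i g (al (fun=> e i) *:
  e i) z - al (fun=> z))).
  move=> a x y; rewrite alL mulrBr addrACA -opprD mulr_sumr -big_split.
  by congr (_ - _); apply: eq_bigr => i _; rewrite (gDr gC gL) (gZr gC gL).
move=> i; rewrite (bigD1 i) //= (gZl gL) ortho.1 eqxx mulr1 big1 ?addr0 ?subrr // => k ki.
by rewrite (gZl gL) ortho.1 (negbTE ki) mulr0.
Qed.

Lemma sharp_pd (j : 'Z_7) : g v (e j) = 6 * int_comb t (phi_entry j).
Proof.
have pdA : alternating_form pd :=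
  hodge_alternating e gC gL (wedge (hodge g e dphi) phi) isT.
rewrite (sharp_spec pdA).
exact: (@pd_components _ _ _ _ ortho.1 _ phiE _ _ dphi_components dphi_antisymmetric j
  (fun=> j)).
Qed.

(** On the frame, [A_v] is the contraction of [pd] with phi, so phi is contracted
twice with [t]. *)
Lemma torsion4E :
  36^-1 *: A_ g phi v = frame_end g e (fun i j => (t i j - t j i - P i j) / 6).
Proof.
have -> : A_ g phi v = frame_end g e (fun i j => 6 * (t i j - t j i - P i j)).
  apply: (linear_ext gL ortho) => [||i j].
  - exact: (A_skew gC gL ortho phiA v).1.
  - exact: (frame_end_linear gC gL).
  rewrite (frame_end_entry gL ortho) /A_ (cross_phi gC gL ortho phiA).
  rewrite -(phi_at_cycle phiA) -(phi_at_cycle phiA).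
  rewrite -[v](frame_coordinates gL ortho) (phi_sum3 e phiA) -phi_contraction mulr_sumr.
  apply: eq_bigr => l _; rewrite sharp_pd (phi_at_basis ortho phiE); ring.
by rewrite scale_frame_end; apply: eq_frame_end => i j; field.
Qed.

Let T1 : V -> V := (84^-1 * form_inner e dphi psi) *: id.

Lemma torsion1E : T1 = frame_end g e (fun i j => (i == j)%:R * tr / 7).
Proof.
rewrite /T1 form_inner_dphi_psi.
set c := 84^-1 * _; apply: (linear_ext gL ortho) => [a x y||i j].
- change (c *: (a *: x + y) = a *: (c *: x) + c *: y).
  by rewrite scalerDr !scalerA mulrC.
- exact: (frame_end_linear gC gL).
rewrite (frame_end_entry gL ortho); change (g (c *: e j) (e i) = (i == j)%:R * tr / 7).
by rewrite (gZl gL) ortho.1 eq_sym /c; field.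
Qed.

Lemma torsion_sum : T = T1 + frame_end g e (fun i j =>
  6^-1 * int_comb t (g2_part_coef i j)) +
  frame_end g e (fun i j => (t i j + t j i) / 2 - (i == j)%:R * tr / 7) +
  36^-1 *: A_ g phi v.
Proof.
rewrite torsion4E torsion1E -!rank_one_sum -!big_split.
under eq_bigr => i _ do rewrite -!big_split.
transitivity (frame_end g e t).
  apply: (linear_ext gL ortho TL) => [|i j]; first exact: (frame_end_linear gC gL).
  by rewrite (frame_end_entry gL ortho).
rewrite -rank_one_sum; apply: eq_bigr => i _; apply: eq_bigr => j _ /=.
by rewrite -!scalerDl; congr (_ *: _); rewrite int_comb_g2_part; field.
Qed.

Lemma cross_scale (a : R) x y : times x (a *: y) = a *: times x y.
Proof.
apply: (frame_ext gL ortho) => i; rewrite (gZl gL) !(cross_phi gC gL ortho phiA).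
rewrite -[a *: y]addr0 (phi_atL2 phiA).
have := phi_atL2 phiA x (e i) (-1) 0 0; rewrite scaler0 addr0 => ->; lra.
Qed.

Lemma int_comb3 (x y z : int) (c d f : nat -> nat -> int) :
  int_comb t (fun m a => x * c m a + y * d m a + z * f m a) =
  x%:~R * int_comb t c + y%:~R * int_comb t d + z%:~R * int_comb t f.
Proof. by rewrite !int_combD !int_combZ. Qed.

Lemma torsion2_g2 : g2_end g phi (frame_end g e (fun i j =>
  6^-1 * int_comb t (g2_part_coef i j))).
Proof.
apply: (frame_end_g2 gC gL ortho phiA phiE) => [i j|i j l].
  by rewrite !int_comb_g2_part P_skew; ring.
transitivity (6^-1 * int_comb t (fun m a => \sum_(k : 'Z_7)
  (phi_entry i j k * g2_part_coef k l m a +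
    phi_entry k j l * g2_part_coef k i m a + phi_entry i k l * g2_part_coef k j m a))).
  rewrite int_comb_sum mulr_sumr; apply: eq_bigr => k _.
  by rewrite (int_comb3 _ _ _ (g2_part_coef k l) (g2_part_coef k i) (g2_part_coef k j));
    ring.
rewrite -[RHS](mulr0 6^-1); congr (_ * _).
rewrite /int_comb big1 // => m _; rewrite big1 // => a _.
rewrite (_ : \sum_k _ = 0) ?mulr0 //.
rewrite -[RHS](eqP (forall7P (forall7P (forall7P (forall7P (forall7P g2_part_coef_g2 i)
  j) l) m) a)).
rewrite sum_belowE; apply: eq_bigr => k _.
by do 3!case: eqP => [->|_]; rewrite ?mul0r.
Qed.

Lemma torsion3_sym : tracefree_sym_end g
  (frame_end g e (fun i j => (t i j + t j i) / 2 - (i == j)%:R * tr / 7)).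
Proof.
split; first exact: (frame_end_linear gC gL).
  by apply: (frame_end_sym gC gL) => i j; rewrite eq_sym [t j i + _]addrC.
move=> e' oe'; rewrite (frame_end_trace gC gL _ ortho oe').
rewrite (eq_bigr (fun i => t i i - tr / 7)) => [|i _]; last by rewrite eqxx mul1r; field.
by rewrite sumrB sumr_const card_ord -/tr -mulr_natl -[(Zp_trunc 7).+2]/7%N; field.
Qed.

(** By [torsion_sum] the four endomorphisms decompose [T], and each of them lies in
its summand. *)
Lemma torsion_components : let T_ := fun k => G2_component g phi k T in
  [/\ T_ 1%N = (84^-1 * form_inner e dphi psi) *: id,
      T_ 2%N = 12^-1 *: (\sum_i \sum_(j | i != j)
        form_inner e (dpsi + 3^-1 *: (wedge pd psi : multiform V 5)) (star2 i j) *: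
          (ten i j - ten j i)),
      T_ 3%N =
        6^-1 *: (\sum_i form_inner e dphi (contracted i i - (4 / 7) *: psi) *: ten i i) +
        12^-1 *: (\sum_(i : 'Z_7) \sum_(j : 'Z_7 | (i < j)%N)
          form_inner e dphi (contracted i j + contracted j i) *: (ten i j + ten j i)) &
      T_ 4%N = 36^-1 *: A_ g phi v].
Proof.
rewrite torsion2E torsion3E -/T1.
pose c (l : nat) : V -> V := match l with
  | 1 => T1
  | 2 => frame_end g e (fun i j => 6^-1 * int_comb t (g2_part_coef i j))
  | 3 => frame_end g e (fun i j => (t i j + t j i) / 2 - (i == j)%:R * tr / 7)
  | _ => 36^-1 *: A_ g phi v end.
have Tc : T = \sum_(1 <= l < 5) c l.
  by rewrite /index_iota /= !big_cons big_nil addr0 !addrA; exact: torsion_sum.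
have cS l : (1 <= l <= 4)%N -> G2_summand g phi l (c l).
  case: l => [|[|[|[|[|l]]]]] // _.
  - by exists (84^-1 * form_inner e dphi psi).
  - exact: torsion2_g2.
  - exact: torsion3_sym.
  - have -> : c 4%N = A_ g phi (36^-1 *: v).
      by apply/funext => x; rewrite /A_ -/times cross_scale.
    exact: (A_g2_perp gC gL ortho phiA phiE).
by split; rewrite (G2_componentE gC gL ortho cS Tc).
Qed.

End TorsionComponents.

(** * Smooth functions and vector fields *)

Section SmoothClosure.
Context {R : realType} {n : nat}.
Implicit Types (U : set 'rV[R]_n.+1) (f h : 'rV[R]_n.+1 -> R).

(** The expansion to first order only involves values near the point. *)
Lemma near_eq_differentiable f h x :
  (\forall y \near x, f y = h y) -> differentiable f x -> differentiable h x.
Proof.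
move=> fh df; have fhx : f x = h x := nbhs_singleton fh.
have E : h \o shift x = cst (h x) + 'd f x +o_ 0 id.
  apply/eqaddoP => eps e0.
  have /eqaddoP/(_ eps e0) := diff_locally df.
  have := fh; rewrite (near_shift 0) subr0.
  apply: filterS2 => y /= fhy; rewrite !fctE /= fhx -fhy; exact.
apply/diff_locallyP; rewrite (diff_unique (diff_continuous df) E).
by split=> //; exact: diff_continuous.
Qed.

Lemma near_open (P : 'rV[R]_n.+1 -> Prop) U x : open U -> U x ->
  (forall y, U y -> P y) -> \forall y \near x, P y.
Proof. by move=> oU Ux UP; apply: filterS UP _; exact: open_nbhs_nbhs. Qed.

Lemma iter_derive_rcons (s : seq 'rV[R]_n.+1) v f :
  iter_derive (rcons s v) f = iter_derive s ('D_v f).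
Proof. by elim: s => //= w s ->. Qed.

Lemma eq_iter_derive U f h : open U -> (forall x, U x -> f x = h x) ->
  forall s x, U x -> iter_derive s f x = iter_derive s h x.
Proof.
move=> oU fh; elim=> [|v s IH] x Ux /=; first exact: fh.
by apply: near_eq_derive; exact: (near_open oU Ux IH).
Qed.

(** Differentiability up to a given order allows induction on the order: by the
Leibniz rule a derivative of a product is a sum of products of functions that
are differentiable up to one order less. *)
Definition differentiable_upto U (m : nat) f : Prop :=
  forall s x, (size s <= m)%N -> U x -> differentiable (iter_derive s f) x.

Lemma eq_differentiable_upto U m f h : open U -> (forall x, U x -> f x = h x) ->
  differentiable_upto U m f -> differentiable_upto U m h.
Proof.
move=> oU fh df s x sm Ux; apply: near_eq_differentiable (df s x sm Ux).
exact: (near_open oU Ux (eq_iter_derive oU fh s)).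
Qed.

Lemma differentiable_uptoS U m f : differentiable_upto U m.+1 f <->
  (forall x, U x -> differentiable f x) /\ forall v, differentiable_upto U m ('D_v f).
Proof.
split=> [df|[df dDf] s x].
  split=> [x Ux|v s x sm Ux]; first exact: (df [::]).
  by rewrite -iter_derive_rcons; apply: df; rewrite ?size_rcons.
case/lastP: s => [|s v]; first by move=> _; exact: df.
by rewrite size_rcons iter_derive_rcons ltnS; exact: dDf.
Qed.

Lemma differentiable_uptoW U m f : differentiable_upto U m.+1 f ->
  differentiable_upto U m f.
Proof. by move=> df s x sm; apply: df; exact: leqW. Qed.

Lemma differentiable_uptoD U m f h : open U ->
  differentiable_upto U m f -> differentiable_upto U m h ->
  differentiable_upto U m (fun x => f x + h x).
Proof.
move=> oU; elim: m f h => [|m IH] f h.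
  move=> df dh [|//] x _ Ux; exact: (differentiableD (df [::] x _ Ux) (dh [::] x _ Ux)).
move=> /differentiable_uptoS[df dDf] /differentiable_uptoS[dh dDh].
apply/differentiable_uptoS; split=> [x Ux|v].
  exact: (differentiableD (df x Ux) (dh x Ux)).
apply: eq_differentiable_upto (IH _ _ (dDf v) (dDh v)) => // x Ux.
by rewrite -deriveD //; apply: diff_derivable; [exact: df|exact: dh].
Qed.

Lemma differentiable_uptoM U m f h : open U ->
  differentiable_upto U m f -> differentiable_upto U m h ->
  differentiable_upto U m (fun x => f x * h x).
Proof.
move=> oU; elim: m f h => [|m IH] f h.
  move=> df dh [|//] x _ Ux; exact: (differentiableM (df [::] x _ Ux) (dh [::] x _ Ux)).
move=> uf uh; have [df dDf] := (differentiable_uptoS U m f).1 uf.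
have [dh dDh] := (differentiable_uptoS U m h).1 uh.
apply/differentiable_uptoS; split=> [x Ux|v].
  exact: (differentiableM (df x Ux) (dh x Ux)).
apply: (@eq_differentiable_upto _ _ (fun x => f x * 'D_v h x + h x * 'D_v f x)) => //.
  move=> x Ux; rewrite -[RHS]/('D_v (f * h) x) deriveM //; apply: diff_derivable; [exact:
    df|exact: dh].
by apply: differentiable_uptoD => //; apply: IH => //; exact: differentiable_uptoW.
Qed.

Lemma smooth_onP U f : smooth_on U f <-> forall m, differentiable_upto U m f.
Proof.
split=> [sf m s x _|df s x Ux]; first exact: sf.
exact: (df (size s)).
Qed.

Lemma smooth_onD U f h : open U -> smooth_on U f -> smooth_on U h ->
  smooth_on U (fun x => f x + h x).
Proof.
move=> oU /smooth_onP sf /smooth_onP sh; apply/smooth_onP => m.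
exact: differentiable_uptoD.
Qed.

Lemma smooth_onM U f h : open U -> smooth_on U f -> smooth_on U h ->
  smooth_on U (fun x => f x * h x).
Proof.
move=> oU /smooth_onP sf /smooth_onP sh; apply/smooth_onP => m.
exact: differentiable_uptoM.
Qed.

Lemma smooth_on_cst U (a : R) : smooth_on U (fun=> a).
Proof.
move=> s x _; suff [b ->] : exists b : R, iter_derive s (fun=> a) = cst b.
  exact: differentiable_cst.
elim: s => [|v s [b sb]] /=; first by exists a.
by exists 0; apply/funext => y; rewrite sb derive_cst.
Qed.

End SmoothClosure.

Section SmoothFields.
Context {R : realType} {n : nat} {M : smooth_manifold R n.+1}.
Implicit Types (U V : set M) (f h : M -> R) (p : M) (X Y : vector_field M).

(** The image is the preimage of [U] by the inverse of the chart. *)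
Lemma chart_image_open (c : chart R n.+1 M) U : open U -> open (c @` (U `&` chart_dom c)).
Proof.
move=> oU.
have -> : c @` (U `&` chart_dom c) = (c @` chart_dom c) `&` (chart_inv c @^-1` U).
  apply/seteqP; split=> [_ [y [Uy cy] <-]|_ [[y cy <-]]] /=.
    by split; [exists y|rewrite (chart_mapK cy)].
  by rewrite (chart_mapK cy) => Uy; exists y.
have oc := @chart_codom_open _ _ _ c.
have := @chart_inv_continuous _ _ _ c; rewrite continuous_open_subspace // => cc.
rewrite openE => x [cx Ux]; apply: filterI; first exact: open_nbhs_nbhs.
by apply: (cc x (mem_set cx)); exact: open_nbhs_nbhs.
Qed.

Lemma smooth_funD U f h : open U -> smooth_fun M U f -> smooth_fun M U h ->
  smooth_fun M U (fun q => f q + h q).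
Proof.
move=> oU sf sh c ac; apply: smooth_onD (sf c ac) (sh c ac).
exact: chart_image_open.
Qed.

Lemma smooth_funM U f h : open U -> smooth_fun M U f -> smooth_fun M U h ->
  smooth_fun M U (fun q => f q * h q).
Proof.
move=> oU sf sh c ac; apply: smooth_onM (sf c ac) (sh c ac).
exact: chart_image_open.
Qed.

Lemma smooth_fun_cst U (a : R) : smooth_fun M U (fun=> a).
Proof. by move=> c _; exact: smooth_on_cst. Qed.

Lemma smooth_funW U V f : V `<=` U -> smooth_fun M U f -> smooth_fun M V f.
Proof.
move=> VU sf c ac s x [y [Vy cy] <-]; apply: (sf c ac).
by exists y => //; split=> //; exact: VU.
Qed.

Lemma smooth_vector_fieldW U V X : V `<=` U -> smooth_vector_field U X ->
  smooth_vector_field V X.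
Proof. by move=> VU sX W f oW WV; apply: sX => //; exact: subset_trans VU. Qed.

Lemma smooth_vector_fieldD U X Y : smooth_vector_field U X -> smooth_vector_field U Y ->
  smooth_vector_field U (fun q => X q + Y q).
Proof.
move=> sX sY V f oV VU sf; apply: smooth_funD => //; [exact: sX|exact: sY].
Qed.

Lemma smooth_vector_fieldZ U f X : smooth_fun M U f -> smooth_vector_field U X ->
  smooth_vector_field U (fun q => f q *: X q).
Proof.
move=> sf sX V h oV VU sh; apply: smooth_funM => //; last exact: sX.
exact: smooth_funW sf.
Qed.

Lemma smooth_vector_field_sum U (I : Type) (r : seq I) (X : I -> vector_field M) :
  (forall i, smooth_vector_field U (X i)) ->
  smooth_vector_field U (fun q => \sum_(i <- r) X i q).
Proof.
move=> sX; elim: r => [|i r IH].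
  move=> V f oV VU sf; rewrite (_ : (fun q => _) = fun=> 0).
    exact: smooth_fun_cst.
  by apply/funext => q; rewrite big_nil.
rewrite (_ : (fun q => _) = (fun q => X i q + \sum_(j <- r) X j q)).
  exact: smooth_vector_fieldD.
by apply: functional_extensionality_dep => q; rewrite big_cons.
Qed.

End SmoothFields.

(** * Derivations and connections *)

Section Derivations.
Context {R : realType} {n : nat} {M : smooth_manifold R n.+1}.
Implicit Types (p : M) (f h : M -> R) (X Y : vector_field M).

Lemma smooth_fun_at_cst p (a : R) : smooth_fun_at p (fun=> a).
Proof. by exists setT; [split=> //; exact: openT|exact: smooth_fun_cst]. Qed.

Lemma open_nbhsI p (U V : set M) : open_nbhs p U -> open_nbhs p V -> open_nbhs p (U `&` V).
Proof. by move=> [oU Up] [oV Vp]; split; [exact: openI|split]. Qed.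

Lemma smooth_fun_atD p f h : smooth_fun_at p f -> smooth_fun_at p h ->
  smooth_fun_at p (fun q => f q + h q).
Proof.
move=> [U Up sf] [V Vp sh]; exists (U `&` V); first exact: open_nbhsI.
by apply: smooth_funD; [exact: openI Up.1 Vp.1|apply: smooth_funW sf|apply:
  smooth_funW sh] => q [].
Qed.

Lemma smooth_fun_atM p f h : smooth_fun_at p f -> smooth_fun_at p h ->
  smooth_fun_at p (fun q => f q * h q).
Proof.
move=> [U Up sf] [V Vp sh]; exists (U `&` V); first exact: open_nbhsI.
by apply: smooth_funM; [exact: openI Up.1 Vp.1|apply: smooth_funW sf|apply:
  smooth_funW sh] => q [].
Qed.

Lemma smooth_fun_atN p f : smooth_fun_at p f -> smooth_fun_at p (fun q => - f q).
Proof.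
move=> sf; rewrite (_ : (fun q => _) = (fun q => (-1) * f q)).
  by apply: smooth_fun_atM => //; exact: smooth_fun_at_cst.
by apply/funext => q; rewrite mulN1r.
Qed.

Lemma smooth_fun_at_sum p (I : Type) (r : seq I) (F : I -> M -> R) :
  (forall i, smooth_fun_at p (F i)) -> smooth_fun_at p (fun q => \sum_(i <- r) F i q).
Proof.
move=> sF; elim: r => [|i r IH].
  rewrite (_ : (fun q => _) = fun=> 0); first exact: smooth_fun_at_cst.
  by apply/funext => q; rewrite big_nil.
rewrite (_ : (fun q => _) = (fun q => F i q + \sum_(j <- r) F j q)).
  exact: smooth_fun_atD.
by apply/funext => q; rewrite big_cons.
Qed.

Variable p : M.
Implicit Types x : tangent p.

Lemma tangent_derivation x : derivation_at p x.
Proof. by have := tangentP x; rewrite /derivation_pred => /asboolP. Qed.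

Lemma tangentD x f h : smooth_fun_at p f -> smooth_fun_at p h ->
  x (fun q => f q + h q) = x f + x h.
Proof. by have [+ _ _ _ _] := tangent_derivation x; apply. Qed.

Lemma tangentM x f h : smooth_fun_at p f -> smooth_fun_at p h ->
  x (fun q => f q * h q) = x f * h p + f p * x h.
Proof. by have [_ _ + _ _] := tangent_derivation x; apply. Qed.

Lemma tangentZ x (a : R) f : smooth_fun_at p f -> x (fun q => a * f q) = a * x f.
Proof. by have [_ + _ _ _] := tangent_derivation x; apply. Qed.

Lemma tangent_near x f h : (\forall q \near p, f q = h q) -> x f = x h.
Proof. by have [_ _ _ + _] := tangent_derivation x; apply. Qed.

(** The Leibniz rule for [1 = 1 * 1]. *)
Lemma tangent_cst x (a : R) : x (fun=> a) = 0.
Proof.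
have s1 := smooth_fun_at_cst p 1.
have : x (fun=> 1) = x (fun=> 1) + x (fun=> 1).
  rewrite -[LHS](tangent_near x (f := fun=> 1 * 1)); last by apply: nearW =>
    q; rewrite mulr1.
  by rewrite tangentM // mulr1 mul1r.
move=> /eqP; rewrite -subr_eq0 opprD addNKr oppr_eq0 => /eqP x1.
rewrite -[LHS](tangent_near x (f := fun=> a * 1)); last by apply: nearW => q; rewrite mulr1.
by rewrite tangentZ // x1 mulr0.
Qed.

Lemma tangentN x f : smooth_fun_at p f -> x (fun q => - f q) = - x f.
Proof.
move=> sf; rewrite -mulN1r -tangentZ //; congr (tangent_val x _).
by apply/funext => q; rewrite mulN1r.
Qed.

Lemma tangent_sum x (I : Type) (r : seq I) (F : I -> M -> R) :
  (forall i, smooth_fun_at p (F i)) ->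
  x (fun q => \sum_(i <- r) F i q) = \sum_(i <- r) x (F i).
Proof.
move=> sF; elim: r => [|i r IH].
  rewrite big_nil -[RHS](tangent_cst x 0); congr (tangent_val x _).
  by apply/funext => q; rewrite big_nil.
rewrite big_cons -IH -tangentD //; last exact: smooth_fun_at_sum.
by congr (tangent_val x _); apply/funext => q; rewrite big_cons.
Qed.

Lemma smooth_fields_at k (Y : 'I_k -> vector_field M) :
  (forall i, smooth_vector_field_at p (Y i)) ->
  exists2 U, open_nbhs p U & forall i, smooth_vector_field U (Y i).
Proof.
move=> sY.
have sY' i : exists U, open_nbhs p U /\ smooth_vector_field U (Y i).
  by have [U Up sU] := sY i; exists U.
have [U hU] := choice sY'.
exists (interior [set q | forall i, U i q]).
  split; first exact: open_interior.
  apply: filter_forall => i.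
  by have [[oU Up] _] := hU i; exact: open_nbhs_nbhs.
move=> i; apply: smooth_vector_fieldW (hU i).2 => q /interior_subset; exact.
Qed.

End Derivations.

Section CovariantDerivatives.
Context {R : realType} {n : nat} {M : smooth_manifold R n.+1}.
Variables (D : connection M) (p : M) (x : tangent p).
Implicit Types (X Y : vector_field M).

Lemma smooth_vector_field_atZ f Y : smooth_fun_at p f -> smooth_vector_field_at p Y ->
  smooth_vector_field_at p (fun q => f q *: Y q).
Proof.
move=> [U Up sf] [V Vp sY]; exists (U `&` V); first exact: open_nbhsI.
apply: smooth_vector_fieldZ; first by apply: smooth_funW sf => q [].
by apply: smooth_vector_fieldW sY => q [].
Qed.

Lemma smooth_vector_field_atD X Y : smooth_vector_field_at p X ->
  smooth_vector_field_at p Y ->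
  smooth_vector_field_at p (fun q => X q + Y q).
Proof.
move=> [U Up sX] [V Vp sY]; exists (U `&` V); first exact: open_nbhsI.
by apply: smooth_vector_fieldD;
  [apply: smooth_vector_fieldW sX|apply: smooth_vector_fieldW sY] => q [].
Qed.

Lemma smooth_vector_field_at0 : smooth_vector_field_at p (fun q => 0).
Proof.
exists setT; first by split=> //; exact: openT.
by move=> V f _ _ _; exact: smooth_fun_cst.
Qed.

Lemma cov0 : cov D p x (fun q => 0) = 0.
Proof.
have E : (fun q : M => 0 *: (0 : tangent q)) = (fun q => 0).
  by apply: functional_extensionality_dep => q; rewrite scale0r.
have := cov_leibniz D x (smooth_fun_at_cst p 0) smooth_vector_field_at0.
by rewrite E tangent_cst !scale0r addr0.
Qed.

(** Smoothness of the sum and the Leibniz rule are proved in one induction, which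
needs both. *)
Lemma cov_sum (I : Type) (r : seq I) (f : I -> M -> R) (Y : I -> vector_field M) :
  (forall i, smooth_fun_at p (f i)) -> (forall i, smooth_vector_field_at p (Y i)) ->
  smooth_vector_field_at p (fun q => \sum_(i <- r) f i q *: Y i q) /\
  cov D p x (fun q => \sum_(i <- r) f i q *: Y i q) =
  \sum_(i <- r) (x (f i) *: Y i p + f i p *: cov D p x (Y i)).
Proof.
move=> sf sY; elim: r => [|i r [sr IH]].
  rewrite big_nil (_ : (fun q => _) = (fun q => 0)).
    by split; [exact: smooth_vector_field_at0|exact: cov0].
  by apply: functional_extensionality_dep => q; rewrite big_nil.
rewrite big_cons (_ : (fun q => _) = (fun q => f i q *: Y i q + \sum_(j <- r) f j q *:
  Y j q)).
  have si := smooth_vector_field_atZ (sf i) (sY i).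
  split; first exact: smooth_vector_field_atD.
  by rewrite cov_add // cov_leibniz // IH.
by apply: functional_extensionality_dep => q; rewrite big_cons.
Qed.

End CovariantDerivatives.

(** * Exterior derivatives and torsion-free connections *)

Section Omitting.

(** Both lists are increasing and have the same elements. *)
Lemma enum_omit k (i : 'I_k.+1) :
  [seq l <- enum 'I_k.+1 | l != i] = [seq lift i a | a <- enum 'I_k].
Proof.
apply: (inj_map val_inj); rewrite -map_comp.
have -> : map val [seq l <- enum 'I_k.+1 | l != i] = seq.filter (fun l : nat =>
  l != val i) (iota 0 k.+1).
  by rewrite -val_enum_ord filter_map.
have -> : map (val \o lift i) (enum 'I_k) = map (bump i) (iota 0 k).
  by rewrite -val_enum_ord -map_comp.
apply: (irr_sorted_eq ltn_trans ltnn).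
- by apply: sorted_filter (iota_ltn_sorted 0 _); exact: ltn_trans.
- rewrite sorted_map; apply: sub_sorted (iota_ltn_sorted 0 k) => a b /=; rewrite /bump; lia.
move=> l; rewrite mem_filter mem_iota /= add0n; apply/andP/mapP => [[li lk]|[a]].
  exists (unbump i l); first by rewrite mem_iota /unbump /=; have := ltn_ord i; lia.
  by rewrite unbumpKcond (negbTE li).
rewrite mem_iota /= add0n => ak ->; split; first by rewrite eq_sym neq_bump.
by rewrite /bump; lia.
Qed.

Lemma enum_omit2 k (i : 'I_k.+2) (b : 'I_k.+1) :
  [seq l <- enum 'I_k.+2 | (l != i) && (l != lift i b)] =
  [seq lift i (lift b a) | a <- enum 'I_k].
Proof.
rewrite (eq_filter (a2 := predI (fun l => l != lift i b) (fun l => l != i))); last first.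
  by move=> l /=; rewrite andbC.
rewrite filter_predI enum_omit filter_map.
rewrite (eq_filter (a2 := fun a => a != b)) ?enum_omit -?map_comp // => a /=.
by rewrite (inj_eq lift_inj).
Qed.

Lemma sum_lift (R : zmodType) k (i : 'I_k.+1) (F : 'I_k.+1 -> R) :
  \sum_(b < k) F (lift i b) = \sum_(j | j != i) F j.
Proof.
rewrite [RHS]big_mkcond (bigD1_ord i) //= eqxx add0r; apply: eq_bigr => b _.
by rewrite eq_sym neq_lift.
Qed.

End Omitting.

Section ExteriorDerivative.
Context {R : realType} {n k : nat} {M : smooth_manifold R n.+1}.
Variables (nabla : connection M) (p : M).
Unset Implicit Arguments.
Variable al : form_field M k.+1.
Set Implicit Arguments.
Variable B : tangent p -> tangent p -> tangent p.
Hypothesis alA : alternating_form (al p).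
Hypothesis al_derive : forall (x : tangent p) (Y : 'I_k.+1 -> vector_field M),
  (forall i, smooth_vector_field_at p (Y i)) ->
  x (fun q => al q (fun i => Y i q)) =
  \sum_(b < k.+1) al p [eta (fun j => Y j p) with b |-> nabla p x (Y b) + B x (Y b p)].
Hypothesis nabla_free : torsion_free nabla.
Hypothesis extend : forall v : tangent p,
  exists2 X : vector_field M, smooth_vector_field_at p X & X p = v.

(** Moving the derived argument to the front turns a covariant derivative in the
first sum into a term of the second one. The connection has no torsion, so these
terms cancel against the brackets. *)
Lemma invariant_d_torsion (X : 'I_k.+2 -> vector_field M) :
  (forall i, smooth_vector_field_at p (X i)) ->
  invariant_d al X p = \sum_(i < k.+2) (-1) ^+ i * \sum_(b < k.+1)
    al p [eta (fun j => X j p) \o lift i with b |-> B (X i p) (X (lift i b) p)].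
Proof.
move=> sX; rewrite /invariant_d.
pose N i j := nabla p (X i p) (X j).
pose rest i j := [seq X l p | l <- enum 'I_k.+2 & (l != i) && (l != j)].
pose G i j z := al p (fun a => (z :: rest i j)`_a).
have GB i j z w : G i j (z - w) = G i j z - G i j w.
  have E u : (fun a : 'I_k.+1 => (u :: rest i j)`_a) =
      [eta (fun a : 'I_k.+1 => (0 :: rest i j)`_a) with ord0 |-> u].
    by apply/funext => -[[|a] ak].
  rewrite /G (E (z - w)) (E z) (E w) addrC -scaleN1r alA.1; ring.
have GE i b z : al p [eta (fun j => X j p) \o lift i with b |-> z] =
    (-1) ^+ b * G i (lift i b) z.
  rewrite (pull_front (alternating_antisymmetric alA) _ b); congr (_ * al p _).
  apply/funext => a; rewrite /rest enum_omit2 -map_comp.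
  case: (unliftP ord0 a) => [a' ->|->]; last by rewrite vcons0 /= eqxx.
  rewrite vconsS /= (nth_map a') ?size_enum_ord ?ltn_ord // nth_ord_enum.
  by rewrite eq_sym (negbTE (neq_lift b a')).
(* The contribution of the derivative of [X j] along [X i]: after the omission of
   [i], the position of [j] is [j - 1] if [i < j] and [j] otherwise. *)
pose H (i j : 'I_k.+2) := (if (i < j)%N then -1 else 1) * (-1) ^+ (i + j) * G i j (N i j).
have S1 : \sum_(i < k.+2) (-1) ^+ i * X i p (fun q => al q (fun a => X (lift i a) q)) =
    \sum_i \sum_(j | j != i) H i j + \sum_(i < k.+2) (-1) ^+ i * \sum_(b < k.+1)
    al p [eta (fun j => X j p) \o lift i with b |-> B (X i p) (X (lift i b) p)].
  rewrite -big_split; apply: eq_bigr => i _ /=.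
  rewrite (al_derive _ (Y := fun a => X (lift i a))) //.
  rewrite (eq_bigr (fun b => al p [eta (fun j =>
    X j p) \o lift i with b |-> N i (lift i b)] +
    al p [eta (fun j => X j p) \o lift i with b |-> B (X i p)
      (X (lift i b) p)])); last first.
    by move=> b _; exact: (alternating_add alA).
  rewrite big_split mulrDr; congr (_ + _); rewrite -sum_lift mulr_sumr.
  apply: eq_bigr => b _; rewrite (GE i b) mulrA /H; congr (_ * _).
  rewrite -exprD /= /bump; case: (leqP i b) => ib /=.
    by rewrite ltnS ib addnA addn1 exprS mulrA mulrNN mulr1 mul1r.
  by rewrite add0n ltnNge (ltnW ib) mul1r.
rewrite S1 -[RHS]addr0 addrAC addrC; congr (_ + _).
have -> : \sum_i \sum_(j | j != i) H i j =
    \sum_(i < k.+2) \sum_(j < k.+2 | (i < j)%N) (H i j + H j i).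
  under [RHS]eq_bigr => i _ do rewrite big_split.
  rewrite big_split /= [X in _ + X](exchange_big_dep predT) //= -big_split.
  apply: eq_bigr => i _ /=; rewrite (bigID (fun j : 'I_k.+2 => (i < j)%N)) /=.
  congr (_ + _); apply: eq_bigl => j.
    by rewrite andbC -val_eqE /=; case: ltngtP.
  by rewrite -leqNgt -val_eqE /= ltn_neqAle.
rewrite -big_split big1 // => i _; rewrite -big_split big1 // => j ij /=.
rewrite -(nabla_free (sX i)
  (sX j)) -/(rest i j) -/(G i j (N i j - N j i)) GB /H ij ltnNge (ltnW ij) /=.
have -> : G j i (N j i) = G i j (N j i).
  rewrite /G /rest; congr (al p _); apply/funext => a; congr (nth _ (_ :: map _ _) _).
  by apply: eq_filter => l; rewrite andbC.
rewrite (addnC j i) -/(N i j) -/(N j i); ring.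
Qed.

(** The right hand side does not depend on the extensions, and extensions exist. *)
Lemma extd_torsion (v : 'I_k.+2 -> tangent p) :
  extd al p v = \sum_(i < k.+2) (-1) ^+ i * \sum_(b < k.+1)
    al p [eta v \o lift i with b |-> B (v i) (v (lift i b))].
Proof.
rewrite /extd; apply: xget_unique => [X sX Xv|r].
  rewrite invariant_d_torsion //; apply: eq_bigr => i _; congr (_ * _).
  have -> : v = fun j => X j p by apply/funext => j; rewrite Xv.
  by [].
have ext' i : exists X : vector_field M, smooth_vector_field_at p X /\ X p = v i.
  by have [X sX Xv] := extend (v i); exists X.
have [X hX] := choice ext'.
have Xv : v = fun j => X j p by apply/funext => j; rewrite (hX j).2.
move=> /(_ X) ->; try by move=> i; have [] := hX i.
rewrite invariant_d_torsion; last by move=> i; have [] := hX i.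
by rewrite Xv.
Qed.

End ExteriorDerivative.

(** * Manifolds with a Cayley frame *)

Section FramedManifold.
Context {R : realType} {M : smooth_manifold R 7} (g : riemannian_metric M).
Variables (phi : G2_structure g) (U : set M) (e : 'Z_7 -> vector_field M) (p : M).
Hypotheses (oU : open U) (frame : cayley_frame g phi U e) (Up : U p).
Implicit Types (x y : tangent p) (X Y Z : vector_field M) (D nabla : connection M).

Let gC q : forall x y : tangent q, g q x y = g q y x := @riemannian_sym _ _ _ g q.
Let gL q : forall a (x y z : tangent q), g q (a *: x + y) z = a * g q x z + g q y z :=
  @riemannian_linear _ _ _ g q.
Let ortho q (Uq : U q) : orthonormal_basis (g q) (fun i => e i q) := (frame.2 q Uq).1.
Let phiE q (Uq : U q) := (frame.2 q Uq).2.
Let phiA q : alternating_form (phi q) := (fundamental_form_smooth phi).1 q.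

Lemma frame_smooth_at i : smooth_vector_field_at p (e i).
Proof. by exists U => //; exact: frame.1. Qed.

Lemma metric_smooth_at Y Z : smooth_vector_field_at p Y -> smooth_vector_field_at p Z ->
  smooth_fun_at p (fun q => g q (Y q) (Z q)).
Proof.
move=> [V Vp sY] [W Wp sZ]; have VWp := open_nbhsI Vp Wp.
exists (V `&` W) => //; apply: (riemannian_smooth g) VWp.1 _ _.
  by apply: smooth_vector_fieldW sY => q [].
by apply: smooth_vector_fieldW sZ => q [].
Qed.

Lemma cov_frame D x Y : smooth_vector_field_at p Y ->
  cov D p x Y = \sum_i (x (fun q => g q (Y q) (e i q)) *: e i p +
                        g p (Y p) (e i p) *: cov D p x (e i)).
Proof.
move=> sY.
have [_ <-] := cov_sum D x (index_enum _) (fun i => metric_smooth_at sY (frame_smooth_at i))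
  frame_smooth_at.
apply: cov_local; apply: filterS (open_nbhs_nbhs (conj oU Up)) => q Uq.
by rewrite (frame_coordinates (@gL q) (ortho Uq)).
Qed.

(** In the expansion of [Y] in the frame, the derivatives of the coefficients are
the same for both connections. *)
Lemma connection_differenceE D nabla x Y : smooth_vector_field_at p Y ->
  connection_difference D nabla x (Y p) = cov D p x Y - cov nabla p x Y.
Proof.
move=> sY; rewrite /connection_difference.
set P := [set z | _].
have : P (\sum_i g p (Y p) (e i p) *: (cov D p x (e i) - cov nabla p x (e i))).
  move=> Z sZ ZY; rewrite !(cov_frame _ _ sZ) -sumrB; apply: eq_bigr => i _.
  by rewrite ZY opprD addrACA subrr add0r scalerBr.
by move=> /(xgetI 0)/(_ Y sY erefl).
Qed.

(** Constant coefficients in the frame extend a tangent vector smoothly. *)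
Lemma frame_extension (v : tangent p) :
  exists2 X : vector_field M, smooth_vector_field_at p X & X p = v.
Proof.
exists (fun q => \sum_i g p v (e i p) *: e i q); last first.
  exact: (frame_coordinates (@gL p) (ortho Up) v).
exists U => //; apply: smooth_vector_field_sum => i.
apply: (smooth_vector_fieldZ (f := fun=> g p v (e i p))); first exact: smooth_fun_cst.
exact: frame.1.
Qed.

Section Parallel.
Variable D : connection M.
Hypotheses (Dg : metric_connection g D) (Dphi : parallel_form D phi).

Lemma frame_skew x i j : g p (cov D p x (e i)) (e j p) = - g p (cov D p x (e j)) (e i p).
Proof.
apply/eqP; rewrite -subr_eq0 opprK [X in _ + X]gC -Dg; try exact: frame_smooth_at.
rewrite -(tangent_cst x (i == j)%:R); apply/eqP/tangent_near.
apply: filterS (open_nbhs_nbhs (conj oU Up)) => q Uq.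
exact: (ortho Uq).1.
Qed.

(** The matrix of the connection in the frame is skew, while a contraction is
symmetric. *)
Lemma frame_contraction (a b : tangent p -> R) x :
  (forall c u v, a (c *: u + v) = c * a u + a v) ->
  (forall c u v, b (c *: u + v) = c * b u + b v) ->
  \sum_k (a (cov D p x (e k)) * b (e k p) + a (e k p) * b (cov D p x (e k))) = 0.
Proof.
move=> aL bL.
have lin_frame (f : tangent p -> R) u : (forall c u v, f (c *: u + v) = c * f u + f v) ->
    f u = \sum_l g p u (e l p) * f (e l p).
  move=> fL; rewrite -[in LHS](frame_coordinates (@gL p) (ortho Up) u).
  elim/big_rec2: _ => [|l y z _ <-]; last by rewrite fL.
  have := fL (-1) 0 0; rewrite scaler0 addr0 => ->; lra.
rewrite big_split /=.
under eq_bigr => k _ do rewrite (lin_frame _ _ aL) mulr_suml.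
under [X in _ + X]eq_bigr => k _ do rewrite (lin_frame _ _ bL) mulr_sumr.
rewrite [X in _ + X]exchange_big -big_split big1 // => k _.
rewrite -big_split big1 // => l _ /=.
by rewrite frame_skew; ring.
Qed.

Lemma phi_at_smooth X Y Z : smooth_vector_field_at p X -> smooth_vector_field_at p Y ->
  smooth_vector_field_at p Z -> smooth_fun_at p (fun q => phi_at (phi q) (X q) (Y q) (Z q)).
Proof.
move=> sX sY sZ.
have [|W Wp sW] := @smooth_fields_at _ _ _ p 3 (tnth [tuple X; Y; Z]).
  by move=> i; rewrite tnth3E; case: ifP => // _; case: ifP.
exists W => //; have := (fundamental_form_smooth phi).2 W _ Wp.1 sW.
congr smooth_fun; apply/funext => q; congr (phi q _); apply/funext => i.
by rewrite !tnth3E; case: ifP => // _; case: ifP.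
Qed.

Lemma phi_at_derive x X Y Z : smooth_vector_field_at p X -> smooth_vector_field_at p Y ->
  smooth_vector_field_at p Z ->
  x (fun q => phi_at (phi q) (X q) (Y q) (Z q)) =
  phi_at (phi p) (cov D p x X) (Y p) (Z p) + phi_at (phi p) (X p) (cov D p x Y) (Z p) +
  phi_at (phi p) (X p) (Y p) (cov D p x Z).
Proof.
move=> sX sY sZ.
have sW i : smooth_vector_field_at p (tnth [tuple X; Y; Z] i).
  by rewrite tnth3E; case: ifP => // _; case: ifP.
have := Dphi x sW.
rewrite (_ : (fun q => _) = (fun q => phi_at (phi q) (X q) (Y q) (Z q))); last first.
  apply/funext => q; congr (phi q _); apply/funext => i.
  by rewrite !tnth3E; case: ifP => // _; case: ifP.
move=> ->; rewrite !big_ord_recl big_ord0 addr0 addrA.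
by congr (_ + _ + _); congr (phi p _); apply/funext => -[[|[|[|//]]] i3];
  rewrite /= ?tnth3E //=.
Qed.

(** Near the point the four-form is built from the metric, phi and a contraction
over the frame, and the Leibniz rule applies to each of them. *)
Lemma star_phi_parallel x (Y : 'I_4 -> vector_field M) :
  (forall i, smooth_vector_field_at p (Y i)) ->
  x (fun q => star_phi phi e q (fun i => Y i q)) =
  \sum_(b < 4) star_phi phi e p [eta (fun j => Y j p) with b |-> cov D p x (Y b)].
Proof.
move=> sY.
pose G i j q := g q (Y i q) (Y j q).
pose F i j k q := phi_at (phi q) (Y i q) (Y j q) (e k q).
have sG i j : smooth_fun_at p (G i j) by exact: metric_smooth_at.
have sF i j k : smooth_fun_at p (F i j k) by apply: phi_at_smooth => //;
  exact: frame_smooth_at.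
rewrite (tangent_near x (h := fun q => G 0 2 q * G 1 3 q + - (G 1 2 q * G 0 3 q) +
    - \sum_k (F 0 1 k q * F 2 3 k q))); last first.
  apply: filterS (open_nbhs_nbhs (conj oU Up)) => q Uq.
  exact: (hodge_cayley (@gC q) (@gL q) (ortho Uq) (@phiA q) (phiE Uq)).
have sGG i j k l : smooth_fun_at p (fun q => G i j q * G k l q)
  := smooth_fun_atM (sG i j) (sG k l).
have sFF k : smooth_fun_at p (fun q => F 0 1 k q * F 2 3 k q)
  := smooth_fun_atM (sF 0 1 k) (sF 2 3 k).
have sS : smooth_fun_at p (fun q => \sum_k F 0 1 k q * F 2 3 k q).
  exact: smooth_fun_at_sum.
rewrite (tangentD x (smooth_fun_atD (sGG _ _ _ _) (smooth_fun_atN (sGG _ _ _ _)))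
  (smooth_fun_atN sS)).
rewrite (tangentD x (sGG _ _ _ _) (smooth_fun_atN (sGG _ _ _ _))).
rewrite (tangentN x (sGG _ _ _ _)) (tangentN x sS) (tangent_sum x _ sFF).
rewrite !(tangentM x (sG _ _) (sG _ _)).
under eq_bigr => k _ do rewrite (tangentM x (sF _ _ _) (sF _ _ _)).
rewrite /G !Dg //.
have dF i j k : x (F i j k) = phi_at (phi p) (cov D p x (Y i)) (Y j p) (e k p) +
    phi_at (phi p) (Y i p) (cov D p x (Y j)) (e k p) +
    phi_at (phi p) (Y i p) (Y j p) (cov D p x (e k)).
  by rewrite /F phi_at_derive //; exact: frame_smooth_at.
under eq_bigr => k _ do rewrite !dF /F.
have Z := frame_contraction x (phi_atL3 (@phiA p) (Y 0 p) (Y 1 p)) (phi_atL3 (@phiA p)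
  (Y 2 p) (Y 3 p)).
have sum4 (f : 'I_4 -> R) : \sum_(b < 4) f b = f 0 + f 1 + f 2 + f 3.
  rewrite !big_ord_recl big_ord0 addr0 !addrA.
  by congr (f _ + f _ + f _ + f _); exact/val_inj.
have star v := hodge_cayley (@gC p) (@gL p) (ortho Up) (@phiA p) (phiE Up) v.
rewrite sum4 /star_phi !star /=.
set S := \sum_k _; set S0 := \sum_k _; set S1 := \sum_k _; set S2 := \sum_k _;
  set S3 := \sum_k _.
have -> : S = S0 + S1 + S2 + S3.
  rewrite -[RHS]addr0 -Z -!big_split; apply: eq_bigr => k _ /=; ring.
ring.
Qed.

End Parallel.
Section Torsion.
Variables (nabla nablaG2 : connection M) (T : forall q : M, tangent q -> tangent q).
Hypothesis LC : levi_civita g nabla.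
Hypothesis minimal : minimal_connection phi nabla nablaG2.
Hypothesis torsionE : forall q (x y : tangent q),
  connection_difference nablaG2 nabla x y = cross (g q) (phi q) y (T x).

Let E i := e i p.

(** The torsion tensor is computed on an extension of its argument. *)
Lemma minimal_connectionE x Y : smooth_vector_field_at p Y ->
  cov nablaG2 p x Y = cov nabla p x Y + cross (g p) (phi p) (Y p) (T x).
Proof.
by move=> sY; rewrite -torsionE connection_differenceE // addrC subrK.
Qed.

Lemma extd_phi (v : 'I_4 -> tangent p) :
  extd phi p v = \sum_(i < 4) (-1) ^+ i * \sum_(b < 3)
    phi p [eta v \o lift i with b |-> cross (g p) (phi p) (v (lift i b)) (T (v i))].
Proof.
have [[Dg Dphi] _] := minimal.
apply: (@extd_torsion _ _ _ _ nabla p phi (fun x y => cross (g p) (phi p) y (T x))).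
- exact: phiA.
- move=> x Y sY; rewrite (Dphi p x Y sY); apply: eq_bigr => b _.
  by rewrite minimal_connectionE.
- exact: LC.2.
- exact: frame_extension.
Qed.

Lemma extd_star_phi (v : 'I_5 -> tangent p) :
  extd (star_phi phi e) p v = \sum_(i < 5) (-1) ^+ i * \sum_(b < 4)
    star_phi phi e p [eta v \o lift i with b |-> cross (g p) (phi p) (v (lift i b))
      (T (v i))].
Proof.
have [[Dg Dphi] _] := minimal.
apply: (@extd_torsion _ _ _ _ nabla p (star_phi phi e) (fun x y => cross (g p)
  (phi p) y (T x))).
- exact: (hodge_alternating E (@gC p) (@gL p) (phi p) isT).
- move=> x Y sY; rewrite (star_phi_parallel Dg Dphi x sY); apply: eq_bigr => b _.
  by rewrite minimal_connectionE.
- exact: LC.2.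
- exact: frame_extension.
Qed.

End Torsion.
End FramedManifold.

Theorem mainTheorem3 (R : realType) (M : smooth_manifold R 7)
    (g : riemannian_metric M) (phi : G2_structure g)
    (nabla nablaG2 : connection M)
    (T : forall p : M, tangent p -> tangent p)
    (U : set M) (e : 'Z_7 -> vector_field M) (p : M) :
  levi_civita g nabla ->
  minimal_connection phi nabla nablaG2 ->
  (forall q, linear (T q)) ->
  (forall q (x y : tangent q),
     connection_difference nablaG2 nabla x y =
     cross (g q) (phi q) y (T q x)) ->
  open U -> cayley_frame g phi U e -> U p ->
  let E := fun i => e i p in
  let dphi := extd phi p in
  let sphi := star_phi phi e p in
  let dsphi := extd (star_phi phi e) p in
  let pd := pdstar_phi phi e p in
  let v := sharp (g p) pd in
  let times := cross (g p) (phi p) in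
  let T_ := fun k => G2_component (g p) (phi p) k (T p) in
  let xi_ := fun k x y => times y (T_ k x) in
  let ten := fun i j => rank_one (g p) (E i) (E j) in
  let dual := fun i => coframe (g p) E (tnth [tuple i]) in
  let T2 := 12^-1 *: \sum_(i : 'Z_7) \sum_(j : 'Z_7 | i != j)
      form_inner E
        (dsphi + 3^-1 *: (wedge pd sphi : multiform (tangent p) 5))
        (hodge (g p) E (wedge (dual i) (dual j)))
      *: (ten i j - ten j i) in
  let T3 :=
      6^-1 *: \sum_(i : 'Z_7)
        form_inner E dphi
          ((wedge (dual i) (interior_product (E i) sphi) : multiform (tangent p) 4)
            - (4 / 7) *: sphi) *: ten i i
    (* unordered pairs: each off-diagonal entry is counted once *)
    + 12^-1 *: \sum_(i : 'Z_7) \sum_(j : 'Z_7 | (i < j)%N)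
        form_inner E dphi
          ((wedge (dual i) (interior_product (E j) sphi) : multiform (tangent p) 4)
            + wedge (dual j) (interior_product (E i) sphi))
        *: (ten i j + ten j i) in
  [/\ T_ 1%N = (84^-1 * form_inner E dphi sphi) *: id /\
      (forall x y, xi_ 1%N x y = (84^-1 * form_inner E dphi sphi) *: times y x),
      T_ 2%N = T2 /\ (forall x y, xi_ 2%N x y = times y (T2 x)),
      T_ 3%N = T3 /\ (forall x y, xi_ 3%N x y = times y (T3 x)) &
      [/\ T_ 4%N = 36^-1 *: A_ (g p) (phi p) v,
          (forall x y, xi_ 4%N x y = 36^-1 *: times y (A_ (g p) (phi p) v x)) &
          (forall x y, xi_ 4%N x y = 36^-1 *: times y (times x v))]].
Proof.
move=> LC minimal TL torsionE oU frame Up E dphi sphi dsphi pd v times T_ xi_ ten dual T2 T3.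
have gC := @riemannian_sym _ _ _ g p.
have gL := @riemannian_linear _ _ _ g p.
have [ortho phiE] := frame.2 p Up.
have phiA := (fundamental_form_smooth phi).1 p.
have dphiE J := extd_phi oU frame Up LC minimal torsionE (E \o J).
have dpsiE J := extd_star_phi oU frame Up LC minimal torsionE (E \o J).
have [T1E T2E T3E T4E] := torsion_components gC gL ortho phiA phiE (TL p) dphiE dpsiE.
have timesZ a x y : times x (a *: y) = a *: times x y.
  exact: (cross_scale gC gL ortho phiA).
split.
- by split=> // x y; rewrite /xi_ /T_ T1E -timesZ.
- by split=> // x y; rewrite /xi_ /T_ T2E.
- by split=> // x y; rewrite /xi_ /T_ T3E.
- by split=> // x y; rewrite /xi_ /T_ T4E -timesZ.
Qed.
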